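(* Let $p$ be an odd prime and let $K$ be a $p$-colorable classical knot. Then equality in the inequality $c(K)\geq \lfloor \log_2 p\rfloor+2$ holds only for the trefoil knot (with $p=3$) and the figure-eight knot (with $p=5$).
   Context: $c(K)$ denotes the crossing number of the knot $K$, and $\lfloor x\rfloor$ is the largest integer less than or equal to $x$. The inequality $c(K)\geq \lfloor \log_2 p\rfloor+2$ is known to hold for every $p$-colorable knot $K$, $p$ an odd prime. As usual in knot tables, a knot type is not distinguished from its mirror image (so ''the trefoil knot'' means either the left- or right-handed trefoil). A (Fox) $p$-coloring of a knot diagram is an assignment of elements of $\mathbb{Z}_p$ to the arcs of the diagram such that at each crossing twice the color of the over-arc equals the sum of the colors of the two under-arcs modulo $p$; it is non-trivial if it uses at least two distinct colors. A knot is $p$-colorable if it has a diagram with a non-trivial $p$-coloring (equivalently, if $p$ divides the determinant of the knot). *)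

(* Defs.v *)
From HB Require Import structures.
From Stdlib Require Import Relations.
From mathcomp Require Import all_boot all_algebra.
From mathcomp Require Import boolp.

Set Implicit Arguments.
Unset Strict Implicit.
Unset Printing Implicit Defensive.

Import GRing.Theory.
Local Open Scope nat_scope.

(* Knot diagrams are planar-diagram (PD) codes: a list of nodes joined by
   edges, which are named by natural numbers.
   - [X a b c d] is a crossing whose four incident edges are, counterclockwise,
     a, b, c, d; the strand a-c passes under the strand b-d.
   - [P a b] is a point marked on the diagram, between the edges a and b.  It
     has no geometric content, but lets two edges be merged, and lets the
     circle without crossings be written [:: P a a]. *)
Inductive node : Type :=
  | X of nat & nat & nat & nat
  | P of nat & nat.

Definition node_code (v : node) : nat * nat * nat * nat + nat * nat :=
  match v with X a b c d => inl (a, b, c, d) | P a b => inr (a, b) end.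

Definition node_decode (s : nat * nat * nat * nat + nat * nat) : node :=
  match s with inl (a, b, c, d) => X a b c d | inr (a, b) => P a b end.

Lemma node_codeK : cancel node_code node_decode.
Proof. by case. Qed.

HB.instance Definition _ := Equality.copy node (can_type node_codeK).

Definition diagram : Type := seq node.

Definition edges_at (v : node) : seq nat :=
  match v with X a b c d => [:: a; b; c; d] | P a b => [:: a; b] end.

Definition edges (D : diagram) : seq nat := flatten (map edges_at D).

Definition map_node (f : nat -> nat) (v : node) : node :=
  match v with
  | X a b c d => X (f a) (f b) (f c) (f d)
  | P a b => P (f a) (f b)
  end.

Definition is_crossing (v : node) : bool :=
  if v is X _ _ _ _ then true else false.

Definition crossings (D : diagram) : nat := count is_crossing D.

Definition degree (D : diagram) (i : 'I_(size D)) : nat :=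
  size (edges_at (tnth (in_tuple D) i)).

(* Half-edges. *)
Definition dart (D : diagram) : finType := {i : 'I_(size D) & 'I_(degree i)}.

Definition edge_of (D : diagram) (d : dart D) : nat :=
  nth 0 (edges_at (tnth (in_tuple D) (tag d))) (tagged d).

(* The other half of the edge of d, when each edge has exactly two halves. *)
Definition other_end (D : diagram) (d : dart D) : dart D :=
  odflt d [pick d' | (d' != d) && (edge_of d' == edge_of d)].

Definition next_ccw (D : diagram) (d : dart D) : dart D :=
  Tagged (fun i : 'I_(size D) => 'I_(degree i)) (ordS (tagged d)).

Definition opposite (D : diagram) (d : dart D) : dart D :=
  iter (degree (tag d))./2 (@next_ccw D) d.

Definition straight_on (D : diagram) (d : dart D) : dart D :=
  opposite (other_end d).

Definition around_face (D : diagram) (d : dart D) : dart D :=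
  next_ccw (other_end d).

(* Each edge has two halves; there is a single component (every component
   contributes two cycles of [straight_on], one for each direction); and the
   diagram, which is then connected, is drawn on the sphere, i.e.
   (number of nodes) - (number of edges) + (number of faces) = 2. *)
Definition knot_diagram (D : diagram) : Prop :=
  [/\ forall x, x \in edges D -> count_mem x (edges D) = 2,
      fcard (@straight_on D) predT = 2 &
      size D + fcard (@around_face D) predT = (size (edges D))./2 + 2].

(* [reorder], [relabel] and [turn_*] change only the way in which a diagram is
   written, and [absorb] removes a marked point (for a = b that point lies on a
   circle without crossings, and stays).
   In [move_R3_*], the edges a0, ..., a5 leave a disc counterclockwise and the
   three strands join a0 to a3, a1 to a4 and a2 to a5; the first strand is on
   top and the two rules differ in which of the other two is at the bottom. *)
Inductive move : diagram -> diagram -> Prop :=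
  | reorder D E : perm_eq D E -> move D E
  | relabel f D : injective f -> move D (map (map_node f) D)
  | turn_X a b c d D : move (X a b c d :: D) (X c d a b :: D)
  | turn_P a b D : move (P a b :: D) (P b a :: D)
  | absorb a b D : a != b ->
      move (P a b :: D) (map (map_node (fun x => if x == b then a else x)) D)
  | move_R1 a b x D : move (X a x x b :: D) (P a b :: D)
  | move_R1' a b x D : move (X a b x x :: D) (P a b :: D)
  | move_R2 a b c d x y D :
      move [:: X c x y a, X y x d b & D] [:: P a b, P c d & D]
  | move_R3_bottom2 a0 a1 a2 a3 a4 a5 x0 x1 x2 D :
      move [:: X a1 x0 x1 a0, X a2 a3 x2 x0, X a5 x1 x2 a4 & D]
           [:: X a2 x1 x2 a1, X a4 x0 x1 a3, X a5 a0 x2 x0 & D]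
  | move_R3_bottom1 a0 a1 a2 a3 a4 a5 x0 x1 x2 D :
      move [:: X a1 x0 x1 a0, X a2 a3 x2 x0, X a4 a5 x1 x2 & D]
           [:: X a1 a2 x1 x2, X a4 x0 x1 a3, X a5 a0 x2 x0 & D].

(* A local replacement counts only between knot diagrams; as [knot_diagram]
   includes planarity, this is what forces the two strands that [move_R2]
   crosses to lie along a common face, and internal edges to be fresh. *)
Definition knot_move (D E : diagram) : Prop :=
  [/\ knot_diagram D, knot_diagram E & move D E].

(* Knot types are classes of knot diagrams under Reidemeister equivalence; a
   knot is given below by any one of its diagrams. *)
Definition same_knot : diagram -> diagram -> Prop :=
  clos_refl_sym_trans diagram knot_move.

Lemma has_crossings (K : diagram) :
  exists n, `[< exists2 D, same_knot K D & crossings D = n >].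
Proof. by exists (crossings K); apply/asboolP; exists K => //; apply: rst_refl. Qed.

Definition crossing_number (K : diagram) : nat := ex_minn (has_crossings K).

(* An arc is a maximal union of edges joined at overcrossings and at marked
   points, so that a colouring of the arcs is a colouring of the edges that is
   constant across these. 'Z_p is the ring of integers mod p only for p > 1. *)
Definition fox_coloring (p : nat) (D : diagram) (f : nat -> 'Z_p) : Prop :=
  forall v, v \in D ->
    match v with
    | X a b c d => f b = f d /\ (2%:R * f b = f a + f c)%R
    | P a b => f a = f b
    end.

Definition nontrivial_coloring (p : nat) (D : diagram) (f : nat -> 'Z_p) : Prop :=
  exists a b, [/\ a \in edges D, b \in edges D & f a <> f b].

Definition colorable (p : nat) (K : diagram) : Prop :=
  exists D, same_knot K D /\
    exists f : nat -> 'Z_p, fox_coloring D f /\ nontrivial_coloring D f.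

Definition mirror (D : diagram) : diagram :=
  map (fun v => if v is X a b c d then X b c d a else v) D.

Definition same_knot_or_mirror (K D : diagram) : Prop :=
  same_knot K D \/ same_knot K (mirror D).

Definition trefoil : diagram := [:: X 1 4 2 5; X 3 6 4 1; X 5 2 6 3].

Definition figure_eight : diagram :=
  [:: X 4 2 5 1; X 8 6 1 5; X 6 3 7 4; X 2 7 3 8].

(* Main.v *)
(* A nontrivial p-colouring of an n-crossing knot diagram lifts to a function on
   the n + 2 faces: because the diagram lies on the sphere, each colouring f of
   the edges has the form f = g(left) + g(right).  After deleting one black and
   one white face of the checkerboard colouring, the crossing relations on g form
   an n x n integer matrix whose determinant p divides.  This determinant is odd,
   hence nonzero: modulo 2 a colouring is constant along the single component.
   Each row is the sum of a black and a white part of the form e_i - e_j, so the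
   determinant is a sum of terms 0, 1, -1 indexed by sets of rows (the spanning
   trees of the black graph), all of the same size k; thus p <= 'C(n, k).
   Moreover among five rows at most 8 of the subsets of given size can
   contribute, since a plane over F_2 has only three nonzero vectors and hence
   four of its vectors are never pairwise independent.  This gives
   p <= 2 ^ (n - 2) for n >= 5, which excludes equality as p is odd.
   So n <= 4, and then n = p = 3 or n = 4, p = 5; in these two cases all Gauss
   codes of planar diagrams are enumerated by computation. *)

(* Five rows are singled out because the subsets of a five-element set number 1, 5, 10, 10, 5, 1 by
   size: only sizes 2 and 3 exceed 8 = 2^3, and there two excluded subsets are enough. Size 3 is
   brought back to size 2 by complementing and exchanging black and white, which is the planar
   duality of spanning trees. Passing to F_2 loses nothing here, since a mixed determinant 1 or -1
   stays nonzero. The number n in the bound is the size of a minimal diagram, while colourability is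
   given on some diagram of the knot. Hence the invariance of colourability under every move, and
   the removal of marked points, after which a minimal diagram consists of crossings only. The bound
   by a binomial coefficient also serves the converse: it shows that the two knots have no diagram
   with fewer crossings than the given ones. *)
From Stdlib Require Import Relations.
Require Import Defs.
From mathcomp Require Import all_boot all_order all_algebra.
From mathcomp Require Import perm boolp ring.

Set Implicit Arguments.
Unset Strict Implicit.
Unset Printing Implicit Defensive.

Import Order.TTheory GRing.Theory Num.Theory.
Local Open Scope nat_scope.

(** * Darts of a diagram *)

(* Passing to the first-return map on the image of [h] keeps the number of
   cycles, provided no two consecutive points are skipped. *)
Lemma fcard_first_return (T T' : finType) (f : T -> T) (g : T' -> T')
    (h : T' -> T) :
  injective f -> injective g -> injective h ->
  (forall x, h (g x) = f (h x) \/
     f (h x) \notin codom h /\ h (g x) = f (f (h x))) ->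
  (forall y, y \notin codom h -> f y \in codom h) ->
  fcard f T = fcard g T'.
Proof.
move=> f_inj g_inj h_inj hg skip.
have fg x y : fconnect g x y -> fconnect f (h x) (h y).
  case/iter_findex=> <-; elim: (findex g x y) => [|m IHm] //=.
  apply: connect_trans IHm _.
  case: (hg (iter m g x)) => [->|[_ ->]]; first exact: fconnect1.
  exact: (fconnect_iter f 2).
have gf m : forall x y, iter m f (h x) = h y -> fconnect g x y.
  elim/ltn_ind: m => [[|[|m]]] IHm x y.
  - by move/h_inj->.
  - rewrite /= => def_y; case: (hg x) => [gx|[]].
      by rewrite (h_inj y (g x)) ?fconnect1 // gx.
    by rewrite def_y codom_f.
  rewrite iterSr => def_y; case: (hg x) => [gx|[_ gx]].
    rewrite -gx in def_y; apply: connect_trans (fconnect1 g x) _.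
    exact: IHm def_y.
  rewrite iterSr -gx in def_y; apply: connect_trans (fconnect1 g x) _.
  exact: IHm def_y.
rewrite (@adjunction_n_comp _ _ h _ (frel g) (fconnect_sym f_inj)
           (fconnect_sym g_inj)) //.
apply: RelAdjunction => [x _|x y _] /=.
  have [hx|/skip hx] := boolP (x \in codom h).
    by exists (iinv hx); rewrite f_iinv connect0.
  by exists (iinv hx); rewrite f_iinv fconnect1.
apply/idP/idP; first exact: fg.
by case/iter_findex/gf.
Qed.

(** Flattens the dependent pair to plain numbers, so that darts of different nodes, and of different
    diagrams, are compared without casts; [locked] keeps simplification from unfolding it. *)
Definition pos (D : diagram) (d : dart D) : nat * nat :=
  locked (nat_of_ord (tag d), nat_of_ord (tagged d)).

Lemma posE (D : diagram) (d : dart D) :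
  pos d = (nat_of_ord (tag d), nat_of_ord (tagged d)).
Proof. by rewrite /pos -lock. Qed.

Lemma pos_inj (D : diagram) : injective (@pos D).
Proof.
case=> [i k] [i' k']; rewrite !posE => -[] /= eq_i; have {}eq_i := val_inj eq_i.
by case: _ / eq_i k' => k' /val_inj ->.
Qed.

Local Notation node_at D i := (nth (P 0 0) D i).

Lemma pos_valid (D : diagram) (d : dart D) :
  (pos d).1 < size D /\ (pos d).2 < size (edges_at (node_at D (pos d).1)).
Proof. by rewrite posE; case: d => i k /=; rewrite -(tnth_nth _ (in_tuple D)). Qed.

Lemma dart_at (D : diagram) (i k : nat) :
  i < size D -> k < size (edges_at (node_at D i)) ->
  exists d : dart D, pos d = (i, k).
Proof.
move=> lt_i lt_k; pose j := Ordinal lt_i.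
have lt_k': k < degree j by rewrite /degree (tnth_nth (P 0 0)).
by exists (Tagged (fun i : 'I_(size D) => 'I_(degree i)) (Ordinal lt_k')); rewrite posE.
Qed.

Lemma edge_of_pos (D : diagram) (d : dart D) :
  edge_of d = nth 0 (edges_at (node_at D (pos d).1)) (pos d).2.
Proof. by rewrite posE /edge_of (tnth_nth (P 0 0)) /=. Qed.

Lemma degree_pos (D : diagram) (d : dart D) :
  degree (tag d) = size (edges_at (node_at D (pos d).1)).
Proof. by rewrite posE /= -(tnth_nth _ (in_tuple D)). Qed.

Lemma pos_next (D : diagram) (d : dart D) :
  pos (next_ccw d) = ((pos d).1, (pos d).2.+1 %% degree (tag d)).
Proof. by rewrite !posE. Qed.

Lemma pos_iter_next (D : diagram) (d : dart D) m :
  pos (iter m (@next_ccw D) d) =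
    ((pos d).1, ((pos d).2 + m) %% degree (tag d)).
Proof.
elim: m => [|m IHm] /=.
  by rewrite addn0 modn_small // posE; case: d => i k /=.
rewrite pos_next IHm /= addnS; congr pair.
have -> : degree (tag (iter m (@next_ccw D) d)) = degree (tag d).
  by rewrite !degree_pos IHm.
by rewrite -addn1 modnDml addn1.
Qed.

Lemma next_ccw_inj (D : diagram) : injective (@next_ccw D).
Proof.
move=> x y eq_xy; apply: pos_inj; have := congr1 (@pos D) eq_xy.
rewrite !pos_next !degree_pos => eq_p.
have eq1 : (pos x).1 = (pos y).1 := congr1 fst eq_p.
have eq2 : (pos x).2.+1 %% _ = (pos y).2.+1 %% _ := congr1 snd eq_p.
rewrite eq1 in eq2.
have [_ x2] := pos_valid x; have [_ y2] := pos_valid y; rewrite eq1 in x2.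
rewrite [pos x]surjective_pairing eq1 [RHS]surjective_pairing; congr pair.
have : (pos x).2 = (pos y).2 %[mod size (edges_at (node_at D (pos y).1))].
  by apply/eqP; rewrite -(eqn_modDr 1) !addn1; apply/eqP.
by rewrite !modn_small.
Qed.

Lemma opposite_inj (D : diagram) : injective (@opposite D).
Proof.
move=> x y eq_xy; have: (pos x).1 = (pos y).1.
  by have := congr1 (@pos D) eq_xy; rewrite !pos_iter_next => -[].
move=> eq1; move: eq_xy; rewrite /opposite !degree_pos eq1.
by elim: _./2 => //= m IHm /next_ccw_inj.
Qed.

Lemma big_dart (D : diagram) (F : dart D -> nat) :
  \sum_d F d = \sum_(i < size D) \sum_(k < degree i)
    F (Tagged (fun i : 'I_(size D) => 'I_(degree i)) k).
Proof. by rewrite sig_big_dep; apply: eq_big => -[i k]. Qed.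

Lemma card_edge (D : diagram) x :
  #|[pred d : dart D | edge_of d == x]| = count_mem x (edges D).
Proof.
rewrite -sum1_card big_mkcond big_dart /edges count_flatten sumnE !big_map.
rewrite (big_tnth _ _ D); apply: eq_bigr => i _.
rewrite -sum1_count (big_nth 0) big_mkord [RHS]big_mkcond.
by apply: eq_bigr => k _; rewrite inE.
Qed.

Lemma card_dart (D : diagram) : #|{: dart D}| = size (edges D).
Proof.
rewrite -sum1_card big_dart size_flatten sumnE !big_map (big_tnth _ _ D).
by apply: eq_bigr => i _; rewrite sum_nat_const card_ord muln1.
Qed.

Definition edges_paired (D : diagram) : Prop :=
  forall x, x \in edges D -> count_mem x (edges D) = 2.

Lemma edge_of_mem (D : diagram) (d : dart D) : edge_of d \in edges D.
Proof. by rewrite -has_pred1 has_count -card_edge; apply/card_gt0P; exists d;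
  apply/eqP. Qed.

Lemma edge_darts (D : diagram) x : x \in edges D -> exists d : dart D, edge_of d = x.
Proof.
rewrite -has_pred1 has_count -card_edge => /card_gt0P[d] /eqP <-.
by exists d.
Qed.

(** An edge name occurring twice is carried by [d] and exactly one other dart, so [pick] succeeds
    and the default of [odflt] is never returned. *)
Lemma other_endP (D : diagram) (d : dart D) : edges_paired D ->
  [/\ other_end d != d, edge_of (other_end d) = edge_of d &
      forall d', edge_of d' = edge_of d -> d' = d \/ d' = other_end d].
Proof.
move=> pairD; have := pairD _ (edge_of_mem d); rewrite -card_edge.
rewrite (cardD1 d) inE eqxx add1n => -[] /mem_card1[y def_y].
rewrite /other_end; case: pickP => [z /andP[/= z_d z_e]|no_z] /=; last first.
  by have := def_y y; have := no_z y; rewrite /= !inE eqxx => ->.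
split=> // [|d' d'e]; first exact/eqP.
have := def_y z; rewrite !inE z_d z_e => /esym/eqP ->.
have := def_y d'; rewrite !inE d'e eqxx andbT.
by case: eqP => [-> _|_ /esym/eqP ->]; [left | right].
Qed.

Section PairedEdges.
Variables (D : diagram) (pairD : edges_paired D).

Lemma other_end_neq (d : dart D) : other_end d != d.
Proof. by have [] := other_endP d pairD. Qed.

Lemma edge_of_other_end (d : dart D) : edge_of (other_end d) = edge_of d.
Proof. by have [] := other_endP d pairD. Qed.

Lemma same_edge (d d' : dart D) :
  edge_of d' = edge_of d -> d' = d \/ d' = other_end d.
Proof. by have [_ _] := other_endP d pairD; apply. Qed.

Lemma other_end_unique (d d' : dart D) :
  d' != d -> edge_of d' = edge_of d -> d' = other_end d.
Proof. by move=> neq /same_edge[] // eq; rewrite eq eqxx in neq. Qed.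

Lemma other_endK : involutive (@other_end D).
Proof.
move=> d; symmetry; apply: other_end_unique; last by rewrite edge_of_other_end.
by rewrite eq_sym other_end_neq.
Qed.

Lemma straight_on_inj : injective (@straight_on D).
Proof. by move=> x y /opposite_inj /(can_inj other_endK). Qed.

Lemma around_face_inj : injective (@around_face D).
Proof. by move=> x y /next_ccw_inj /(can_inj other_endK). Qed.

End PairedEdges.

(** * Rewriting a diagram *)

Lemma knot_paired (D : diagram) : knot_diagram D -> edges_paired D.
Proof. by case. Qed.

Lemma paired_map_perm (D E : diagram) (f : nat -> nat) :
  injective f -> perm_eq (edges E) (map f (edges D)) ->
  edges_paired D -> edges_paired E.
Proof.
move=> f_inj eqE pairD x; rewrite (perm_mem eqE) (seq.permP eqE) => /mapP[y y_D ->].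
rewrite count_map -(pairD y y_D); apply: eq_count => z /=.
by rewrite inj_eq.
Qed.

Lemma opposite_degree4 (D : diagram) (d : dart D) :
  degree (tag d) = 4 -> opposite d = next_ccw (next_ccw d).
Proof. by rewrite /opposite => ->. Qed.

(* The node [i] of [E] is the node [q i] of [D], with edges renamed by [f] and
   listed from another starting point. *)
Lemma knot_iso (D E : diagram) (q r f : nat -> nat) :
  injective f -> size D = size E ->
  perm_eq (edges E) (map f (edges D)) ->
  {in gtn (size E), forall i, q i < size D} ->
  {in gtn (size E) &, injective q} ->
  (forall i, i < size E ->
     let v := edges_at (node_at D (q i)) in
     let w := edges_at (node_at E i) in
     size v = size w /\
     forall k, k < size w -> nth 0 w k = f (nth 0 v ((k + r i) %% size w))) ->
  knot_diagram D -> knot_diagram E.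
Proof.
move=> f_inj eq_sz eqE q_lt q_inj nodeE [pairD one_comp sphere].
have pairE : edges_paired E := paired_map_perm f_inj eqE pairD.
have szE : size (edges E) = size (edges D) by rewrite (perm_size eqE) size_map.
have /choice[h hP] (d : dart E) : exists d' : dart D,
    pos d' = (q (pos d).1, ((pos d).2 + r (pos d).1) %% degree (tag d)).
  have [lt1 lt2] := pos_valid d.
  have [sz _] := nodeE _ lt1.
  apply: dart_at; first exact: q_lt.
  by rewrite sz degree_pos ltn_mod (leq_trans _ lt2).
have pos1 d : (pos (h d)).1 = q (pos d).1 by rewrite hP.
have deg d : degree (tag (h d)) = degree (tag d).
  rewrite !degree_pos pos1; have [lt1 _] := pos_valid d.
  by have [] := nodeE _ lt1.
have h_edge d : f (edge_of (h d)) = edge_of d.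
  rewrite !edge_of_pos hP /= degree_pos; have [lt1 lt2] := pos_valid d.
  by have [_ ->] := nodeE _ lt1.
have h_inj : injective h.
  move=> x y /(congr1 (@pos D)); rewrite !hP => eq_p.
  have [x1 x2] := pos_valid x; have [y1 y2] := pos_valid y.
  have eq_q : q (pos x).1 = q (pos y).1 := congr1 fst eq_p.
  have eq1 : (pos x).1 = (pos y).1 by apply: q_inj.
  have eq2 : ((pos x).2 + r _) %% _ = ((pos y).2 + r _) %% _ := congr1 snd eq_p.
  rewrite !degree_pos eq1 in eq2; rewrite eq1 in x2.
  apply: pos_inj; rewrite [LHS]surjective_pairing eq1 [RHS]surjective_pairing.
  congr pair; move/eqP: eq2; rewrite eqn_modDr => /eqP.
  by rewrite !modn_small.
have h_next d : h (next_ccw d) = next_ccw (h d).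
  apply: pos_inj; rewrite hP !pos_next [in RHS]hP deg.
  have -> : degree (tag (next_ccw d)) = degree (tag d) by [].
  rewrite [in LHS]/fst [in LHS]/snd; congr pair.
  by rewrite modnDml addSn -[in RHS]addn1 modnDml addn1.
have h_iter m d : h (iter m (@next_ccw E) d) = iter m (@next_ccw D) (h d).
  by elim: m => //= m <-.
have h_other d : h (other_end d) = other_end (h d).
  apply: other_end_unique => //; first by rewrite (inj_eq h_inj) other_end_neq.
  by apply: f_inj; rewrite !h_edge edge_of_other_end.
have h_onto y : y \in codom h.
  by apply: inj_card_onto; rewrite // !card_dart szE.
have eq_card f1 f2 : injective f1 -> injective f2 ->
    (forall d, h (f2 d) = f1 (h d)) -> fcard f1 (dart D) = fcard f2 (dart E).
  move=> inj1 inj2 eq_f; apply: fcard_first_return h_inj _ _ => // x.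
  by left.
split=> //.
  rewrite -one_comp; symmetry; apply: eq_card => [||d].
  - exact: straight_on_inj.
  - exact: straight_on_inj.
  by rewrite /straight_on /opposite h_iter h_other -deg h_other.
rewrite szE -sphere eq_sz; congr (_ + _); symmetry; apply: eq_card => [||d].
- exact: around_face_inj.
- exact: around_face_inj.
by rewrite /around_face h_next h_other.
Qed.

Lemma edges_map_node f (D : diagram) :
  edges (map (map_node f) D) = map f (edges D).
Proof. by rewrite /edges map_flatten -!map_comp; congr flatten; apply: eq_map;
  case. Qed.

Lemma perm_edges (D E : diagram) : perm_eq D E -> perm_eq (edges D) (edges E).
Proof. by move=> eqDE; apply: perm_flatten; apply: perm_map. Qed.

Lemma knot_relabel f (D : diagram) :
  injective f -> knot_diagram D -> knot_diagram (map (map_node f) D).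
Proof.
move=> f_inj; apply: (knot_iso (q := id) (r := fun _ => 0) f_inj) => //.
- by rewrite size_map.
- by rewrite edges_map_node.
- by move=> i; rewrite inE size_map.
move=> i; rewrite size_map => lt_i; rewrite (nth_map (P 0 0)) //=.
case: (nth _ D i) => [a b c d|a b] /=; split=> // k; rewrite addn0.
  by move: k; do 4!case=> //.
by move: k; do 2!case=> //.
Qed.

Lemma knot_reorder (D E : diagram) :
  perm_eq D E -> knot_diagram D -> knot_diagram E.
Proof.
move=> eqDE; have/(perm_iotaP (P 0 0))[Is eqIs defE] : perm_eq E D by rewrite perm_sym.
have szE := perm_size eqDE.
have szIs : size Is = size E by rewrite (perm_size eqIs) size_iota.
apply: (knot_iso (q := nth 0 Is) (r := fun _ => 0) (f := id)) => //.
- by rewrite map_id perm_sym; apply: perm_edges.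
- move=> i; rewrite inE -szIs => lt_i; have := mem_nth 0 lt_i.
  by rewrite (perm_mem eqIs) mem_iota.
- move=> i j; rewrite !inE -szIs => lt_i lt_j /eqP.
  by rewrite nth_uniq ?(perm_uniq eqIs) ?iota_uniq // => /eqP.
move=> i lt_i.
have -> : node_at E i = node_at D (nth 0 Is i).
  by rewrite {1}defE (nth_map 0) ?szIs.
by split=> // k lt_k; rewrite addn0 modn_small.
Qed.

Definition quarter_turn (v : node) : node :=
  if v is X a b c d then X b c d a else v.

(** A quarter turn exchanges the over- and under-strand, but [knot_diagram] sees only the cyclic
    order of edges at each node, that is, the shadow of the diagram. *)
Lemma knot_quarter_turn v (D : diagram) :
  knot_diagram (v :: D) -> knot_diagram (quarter_turn v :: D).
Proof.
case: v => [a b c d|//].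
apply: (knot_iso (q := id) (r := fun i => i == 0) (f := id)) => //.
  rewrite map_id.
  change (perm_eq (rcons [:: b; c; d] a ++ edges D)
                  ((a :: [:: b; c; d]) ++ edges D)).
  by rewrite perm_cat2r perm_rcons.
move=> i _; case: i => [|i] /=; last first.
  by split=> // k lt_k; rewrite addn0 modn_small.
split; first by [].
case=> [|[|[|[|k]]]] lt_k; last by exfalso; move: lt_k.
- by [].
- by [].
- by [].
by [].
Qed.

(** Without the point, [straight_on] and [around_face] jump over its two darts [al] and [be]; they
    are first-return maps and keep their numbers of cycles. Nodes and edges both drop by one, so
    Euler's relation persists. *)
Lemma knot_absorb a b (D : diagram) : a != b ->
  knot_diagram (P a b :: D) ->
  knot_diagram (map (map_node (fun x => if x == b then a else x)) D).
Proof.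
set sub := fun x => _; set E := map _ _; set D' := P a b :: D.
move=> neq_ab [pairD one_comp sphere].
have edgesD : edges D' = [:: a, b & edges D] by [].
have edgesE : edges E = map sub (edges D) by apply: edges_map_node.
have count_a : count_mem a (edges D) = 1.
  have := pairD a; rewrite edgesD inE eqxx /= eqxx (eq_sym b) (negPf neq_ab).
  by move=> /(_ isT) [].
have count_b : count_mem b (edges D) = 1.
  have := pairD b; rewrite edgesD !inE eqxx orbT /= eqxx (negPf neq_ab).
  by move=> /(_ isT) [].
have pairE : edges_paired E.
  move=> x; rewrite edgesE => /mapP[y y_D ->]; rewrite count_map.
  have [y_ab|] := boolP ((y == a) || (y == b)).
    have -> : sub y = a by rewrite /sub; case/orP: y_ab => /eqP->;
      rewrite ?eqxx ?if_same.
    transitivity (count (predU (pred1 a) (pred1 b)) (edges D)).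
      apply: eq_count => z /=; rewrite /sub; case: ifP => [/eqP->|_] /=.
        by rewrite eqxx orbT.
      by rewrite orbF.
    have noI : count (predI (pred1 a) (pred1 b)) (edges D) = 0.
      rewrite -(count_pred0 (edges D)); apply: eq_count => z /=.
      by apply/negP=> /andP[/eqP-> ]; rewrite (negPf neq_ab).
    by have := count_predUI (pred1 a) (pred1 b) (edges D);
      rewrite noI addn0 count_a count_b.
  rewrite negb_or => /andP[y_a y_b].
  rewrite -(pairD y); last by rewrite edgesD !inE y_D !orbT.
  rewrite edgesD /= !(eq_sym _ y) (negPf y_a) (negPf y_b) /=.
  apply: eq_count => z /=; rewrite /sub (negPf y_b).
  by case: ifP => // /eqP->; rewrite !(eq_sym _ y); rewrite (negPf y_a) (negPf y_b).
have szE : size E = size D by rewrite size_map.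
have nodeE i : i < size D -> node_at E i = map_node sub (node_at D i).
  by move=> lt_i; rewrite (nth_map (P 0 0)).
have size_sub v : size (edges_at (map_node sub v)) = size (edges_at v) by case: v.
have /choice[h hP] (d : dart E) : exists d' : dart D',
    pos d' = ((pos d).1.+1, (pos d).2).
  have [lt1 lt2] := pos_valid d; rewrite szE in lt1.
  by apply: dart_at; rewrite //= -size_sub -nodeE.
have deg d : degree (tag (h d)) = degree (tag d).
  rewrite !degree_pos hP /=; have [lt1 _] := pos_valid d; rewrite szE in lt1.
  by rewrite nodeE // size_sub.
have h_edge d : sub (edge_of (h d)) = edge_of d.
  rewrite !edge_of_pos hP /=; have [lt1 lt2] := pos_valid d.
  rewrite szE in lt1; rewrite nodeE // size_sub in lt2 *.
  move: lt2; case: (node_at D _) => [e1 e2 e3 e4|e1 e2]; move: (pos d).2 => k.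
    by do 4!case: k => [|k] //.
  by do 2!case: k => [|k] //.
have h_inj : injective h.
  move=> x y /(congr1 (@pos D')); rewrite !hP => eq_p.
  have [eq1] : (pos x).1.+1 = (pos y).1.+1 := congr1 fst eq_p.
  have eq2 : (pos x).2 = (pos y).2 := congr1 snd eq_p.
  by apply: pos_inj; rewrite [LHS]surjective_pairing eq1 eq2 -surjective_pairing.
have h_iter m d : h (iter m (@next_ccw E) d) = iter m (@next_ccw D') (h d).
  by apply: (@pos_inj D'); rewrite hP !pos_iter_next hP deg.
have h_codom y : (y \in codom h) = (0 < (pos y).1).
  apply/codomP/idP => [[x ->]|]; first by rewrite hP.
  have [lt1 lt2] := pos_valid y; move: lt1 lt2; case def_y: (pos y) => [[|i] k] //=.
  rewrite ltnS => lt1 lt2 _; have [] := @dart_at E i k; rewrite ?szE //.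
    by rewrite nodeE // size_sub.
  by move=> x def_x; exists x; apply: (@pos_inj D'); rewrite hP def_x def_y.
have [al def_al] : exists al : dart D', pos al = (0, 0) by apply: dart_at.
have [be def_be] : exists be : dart D', pos be = (0, 1) by apply: dart_at.
have edge_al : edge_of al = a by rewrite edge_of_pos def_al.
have edge_be : edge_of be = b by rewrite edge_of_pos def_be.
have deg_al : degree (tag al) = 2 by rewrite degree_pos def_al.
have deg_be : degree (tag be) = 2 by rewrite degree_pos def_be.
have next_al : next_ccw al = be by apply: (@pos_inj D');
  rewrite pos_next def_be deg_al def_al.
have next_be : next_ccw be = al by apply: (@pos_inj D');
  rewrite pos_next def_al deg_be def_be.
have opp_al : opposite al = be by rewrite /opposite deg_al.
have opp_be : opposite be = al by rewrite /opposite deg_be.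
have al_h : al \notin codom h by rewrite h_codom def_al.
have be_h : be \notin codom h by rewrite h_codom def_be.
have not_h y : y \notin codom h -> y = al \/ y = be.
  rewrite h_codom -leqNgt leqn0 => /eqP y1; have [_] := pos_valid y.
  rewrite y1 /= => y2; case def_y: (pos y).2 y2 => [|[|k]] // _.
    by left; apply: (@pos_inj D'); rewrite def_al [LHS]surjective_pairing y1 def_y.
  by right; apply: (@pos_inj D'); rewrite def_be [LHS]surjective_pairing y1 def_y.
have other_codom y : y \notin codom h -> other_end y \in codom h.
  move=> y_h; apply: contraT => /not_h.
  have neq_y := other_end_neq pairD y; have := edge_of_other_end pairD y.
  move/eqP: neq_y; case: (not_h _ y_h) => -> neq_y eq_e [] eq_o.
  - by case: neq_y.
  - by rewrite eq_o edge_al edge_be in eq_e; rewrite eq_e eqxx in neq_ab.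
  - by rewrite eq_o edge_al edge_be in eq_e; rewrite eq_e eqxx in neq_ab.
  by case: neq_y.
(* Either the edge of [d] comes unchanged from [D'], or in [D'] it leads to a dart [ga] of the point
   and goes on from the other dart of the point. *)
have h_other d : h (other_end d) = other_end (h d) \/
    exists ga : dart D', [/\ ga \notin codom h, other_end (h d) = ga &
      other_end (next_ccw ga) = h (other_end d) /\ opposite ga = next_ccw ga].
  have y_neq : h (other_end d) != h d by rewrite (inj_eq h_inj) other_end_neq.
  have := edge_of_other_end pairE d; rewrite -!h_edge => eq_sub.
  have al_neq x : al != h x by apply: contraNneq al_h => ->; apply: codom_f.
  have be_neq x : be != h x by apply: contraNneq be_h => ->; apply: codom_f.
  have [eq_e|neq_e] := eqVneq (edge_of (h (other_end d))) (edge_of (h d)).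
    by left; apply: other_end_unique.
  right; move: eq_sub; rewrite /sub; case: eqP => [yb|/eqP yb];
    case: eqP => [db|/eqP db].
  - by rewrite yb db eqxx in neq_e.
  - move=> da; exists al; split=> //.
      by symmetry; apply: other_end_unique; rewrite // edge_al.
    rewrite next_al opp_al; split=> //.
    by symmetry; apply: other_end_unique; rewrite ?edge_be // eq_sym.
  - move=> ya; exists be; split=> //.
      by symmetry; apply: other_end_unique; rewrite // edge_be.
    rewrite next_be opp_be; split=> //.
    by symmetry; apply: other_end_unique; rewrite ?edge_al // eq_sym.
  by move=> eq_e; rewrite eq_e eqxx in neq_e.
have codom_iter m y : y \in codom h -> iter m (@next_ccw D') y \in codom h.
  by case/codomP=> x ->; rewrite -h_iter codom_f.
split=> //.
  rewrite -one_comp; symmetry; apply: fcard_first_return h_inj _ _ => [||d|y y_h].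
  - exact: straight_on_inj.
  - exact: straight_on_inj.
  - rewrite /straight_on.
    have h_opp x : h (opposite x) = opposite (h x) by rewrite /opposite h_iter deg.
    case: (h_other d) => [eq_d|[ga [ga_h -> [eq_ga opp_ga]]]].
      by left; rewrite h_opp eq_d.
    right; rewrite opp_ga h_opp eq_ga; split=> //.
    by case: (not_h _ ga_h) => ->; rewrite ?next_al ?next_be.
  by apply: codom_iter; apply: other_codom.
have -> : fcard (@around_face E) (dart E) = fcard (@around_face D') (dart D').
  symmetry; apply: fcard_first_return h_inj _ _ => [||d|y y_h].
  - exact: around_face_inj.
  - exact: around_face_inj.
  - rewrite /around_face.
    have h_next x : h (next_ccw x) = next_ccw (h x) by apply: (h_iter 1).
    case: (h_other d) => [eq_d|[ga [ga_h -> [eq_ga opp_ga]]]].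
      by left; rewrite h_next eq_d.
    right; rewrite h_next eq_ga; split=> //.
    by case: (not_h _ ga_h) => ->; rewrite ?next_al ?next_be.
  by apply: (codom_iter 1); apply: other_codom.
by rewrite szE edgesE size_map; apply: succn_inj; apply: sphere.
Qed.

(** * The walk along a knot *)

Section Walk.
Variables (D : diagram) (knotD : knot_diagram D).
Let pairD : edges_paired D := knot_paired knotD.

Lemma half_degree (d : dart D) :
  degree (tag d) = (degree (tag d))./2 + (degree (tag d))./2 /\
  0 < (degree (tag d))./2.
Proof. by rewrite !degree_pos; case: (node_at D _). Qed.

Lemma oppositeK : involutive (@opposite D).
Proof.
move=> d; rewrite {1}/opposite.
have -> : degree (tag (opposite d)) = degree (tag d).
  by rewrite !degree_pos pos_iter_next.
rewrite /opposite -iterD; have [deg2 _] := half_degree d; rewrite -deg2.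
apply: pos_inj; rewrite pos_iter_next modnDr modn_small -?surjective_pairing //.
by rewrite degree_pos; case: (pos_valid d).
Qed.

Lemma opposite_neq (d : dart D) : opposite d != d.
Proof.
apply/eqP=> /(congr1 (@pos D)); rewrite pos_iter_next => eq_p.
have eq2 : ((pos d).2 + _) %% _ = (pos d).2 := congr1 snd eq_p.
have [_ lt2] := pos_valid d; rewrite -degree_pos in lt2.
have [deg2 half_gt0] := half_degree d.
move: eq2; rewrite -[RHS](modn_small lt2) -[X in _ = X %% _]addn0 => /eqP.
rewrite eqn_modDl mod0n modn_small ?eqn0Ngt ?half_gt0 //.
by rewrite [X in _ < X]deg2 -addn1 leq_add2l.
Qed.

Lemma straight_on_back (x : dart D) :
  straight_on (other_end (straight_on x)) = other_end x.
Proof. by rewrite /straight_on other_endK // oppositeK. Qed.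

Lemma iter_straight_on_back j (x : dart D) :
  iter j (@straight_on D) (other_end (iter j (@straight_on D) x)) = other_end x.
Proof.
elim: j x => // j IHj x; rewrite [in X in other_end X]iterSr iterS IHj.
exact: straight_on_back.
Qed.

(* Reversal maps [straight_on] to its inverse, so a reversal within one cycle
   would fix a dart or exchange a dart with its opposite. *)
Lemma straight_on_reverse (d : dart D) :
  ~~ fconnect (@straight_on D) d (other_end d).
Proof.
apply/negP=> /iter_findex; move: (findex _ _ _) => k.
have s_inj := straight_on_inj pairD.
have iter_inj j : injective (iter j (@straight_on D)).
  by elim: j => // j IHj x y /s_inj /IHj.
rewrite -(odd_double_half k) -addnn -(iter_straight_on_back k./2) [_ + (_ + _)]addnCA.
rewrite iterD => /iter_inj; rewrite iterD; set y := iter _ _ d.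
case: (odd k) => /= eq_y.
  have /eqP[] := opposite_neq (other_end y).
  exact: eq_y.
by have /eqP[] := other_end_neq pairD y.
Qed.

(** By [straight_on_reverse] the two given cycles differ; a dart outside both would yield a third
    root. *)
Lemma two_orbits (d x : dart D) :
  fconnect (@straight_on D) d x \/ fconnect (@straight_on D) (other_end d) x.
Proof.
have s_inj := straight_on_inj pairD.
have sym := fconnect_sym s_inj.
have [_ two _] := knotD.
apply/orP; rewrite -!(root_connect sym); move/eqP: two; apply: contraTT.
rewrite negb_or => /andP[neq1 neq2].
have neq0 := straight_on_reverse d; rewrite -(root_connect sym) in neq0.
pose r := froot (@straight_on D).
have : #|[set r d; r (other_end d); r x]| <= fcard (@straight_on D) (dart D).
  apply: subset_leq_card; apply/subsetP=> y.
  by rewrite !inE => /orP[/orP[]|] /eqP->; rewrite andbT; exact: roots_root.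
rewrite setUC !cardsU1 cards1 !inE negb_or eq_sym neq1 eq_sym neq2 neq0.
by apply: contraTneq => ->.
Qed.

End Walk.

(** Both darts of the point are fixed by [straight_on], so they use up the two cycles and leave none
    for a further node. *)
Lemma knot_point_loop a (D : diagram) : knot_diagram (P a a :: D) -> D = [::].
Proof.
set D' := P a a :: D => knotD; have pairD := knot_paired knotD.
have [al def_al] : exists al : dart D', pos al = (0, 0) by apply: dart_at.
have [be def_be] : exists be : dart D', pos be = (0, 1) by apply: dart_at.
have edge_al : edge_of al = a by rewrite edge_of_pos def_al.
have edge_be : edge_of be = a by rewrite edge_of_pos def_be.
have deg_al : degree (tag al) = 2 by rewrite degree_pos def_al.
have deg_be : degree (tag be) = 2 by rewrite degree_pos def_be.
have neq_al : al != be.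
  by apply/eqP=> /(congr1 (@pos D')); rewrite def_al def_be.
have other_al : other_end al = be.
  by symmetry; apply: other_end_unique; rewrite ?edge_al ?edge_be // eq_sym.
have other_be : other_end be = al by rewrite -other_al other_endK.
have s_al : straight_on al = al.
  rewrite /straight_on other_al /opposite deg_be /=; apply: (@pos_inj D').
  by rewrite pos_next def_be deg_be def_al.
have s_be : straight_on be = be.
  rewrite /straight_on other_be /opposite deg_al /=; apply: (@pos_inj D').
  by rewrite pos_next def_al deg_al def_be.
have fix_orbit (x y : dart D') : straight_on x = x -> fconnect (@straight_on
  D') x y -> y = x.
  by move=> sx /iter_findex <-; elim: findex => //= m ->.
case def_D: D => [//|v D1].
have [y def_y] : exists y : dart D', pos y = (1, 0).
  by apply: dart_at; rewrite /D' def_D //=; case: (v).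
have [/(fix_orbit _ _ s_al) eq_y|] := two_orbits knotD al y.
  by rewrite eq_y def_al in def_y.
rewrite other_al => /(fix_orbit _ _ s_be) eq_y.
by rewrite eq_y def_be in def_y.
Qed.

(** * Equivalence of rewritten diagrams and removal of marked points *)

Lemma same_knot_trans (D E F : diagram) :
  same_knot D E -> same_knot E F -> same_knot D F.
Proof. exact: rst_trans. Qed.

Lemma same_knot_sym (D E : diagram) : same_knot D E -> same_knot E D.
Proof. exact: rst_sym. Qed.

Lemma same_knot_diagram (D E : diagram) :
  same_knot D E -> knot_diagram D <-> knot_diagram E.
Proof.
elim=> {D E} [D E [knotD knotE _]|D|D E _ [? ?]|D E F _ [? ?] _ [? ?]].
- by split.
- by [].
- by split.
by split; auto.
Qed.

Lemma same_knot_move (D E : diagram) :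
  knot_diagram D -> knot_diagram E -> move D E -> same_knot D E.
Proof. by move=> knotD knotE DE; apply: rst_step. Qed.

Lemma same_knot_reorder (D E : diagram) :
  perm_eq D E -> knot_diagram D -> same_knot D E.
Proof.
move=> DE knotD; apply: same_knot_move => //; last exact: reorder.
exact: knot_reorder DE knotD.
Qed.

Lemma same_knot_relabel f (D : diagram) : injective f ->
  knot_diagram D -> same_knot D (map (map_node f) D).
Proof.
move=> f_inj knotD; apply: same_knot_move => //; last exact: relabel.
exact: knot_relabel.
Qed.

Definition half_turn (v : node) : node := quarter_turn (quarter_turn v).

Lemma knot_half_turn v (D : diagram) :
  knot_diagram (v :: D) -> knot_diagram (half_turn v :: D).
Proof. by move=> knotD; do 2!apply: knot_quarter_turn. Qed.

Lemma same_knot_half_turn v (D : diagram) : knot_diagram (v :: D) ->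
  same_knot (v :: D) (half_turn v :: D).
Proof.
case: v => [a b c d|a b] knotD; last exact: rst_refl.
by apply: same_knot_move (turn_X _ _ _ _ _) => //; exact: knot_half_turn knotD.
Qed.

(** Used for crossing changes: in the normal form of a node these are quarter turns in one direction
    or the other, the latter written as [iter 3]. *)
Lemma knot_turns (D E : diagram) :
  all2 (fun v w => w \in [:: v; quarter_turn v; iter 3 quarter_turn v]) D E ->
  knot_diagram D -> knot_diagram E.
Proof.
suff main D0 : all2 (fun v w => w \in [:: v; quarter_turn v;
  iter 3 quarter_turn v]) D E ->
    knot_diagram (D0 ++ D) -> knot_diagram (D0 ++ E) by exact: (main [::]).
elim: D E D0 => [|v D IHD] [|w E] //= D0 /andP[vw DE] knotD.
have permD u : perm_eq (D0 ++ u :: D) (u :: (D0 ++ D)).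
  by rewrite -cat1s perm_catCA.
have knotD1 := knot_reorder (permD _) knotD.
have knotE1 : knot_diagram (w :: (D0 ++ D)).
  by move: vw; rewrite !inE => /or3P[]/eqP-> //; do ?apply: knot_quarter_turn.
rewrite -cat_rcons; apply: IHD => //; rewrite cat_rcons.
by apply: knot_reorder knotE1; rewrite perm_sym.
Qed.

Lemma same_knot_half_turns (D E : diagram) :
  all2 (fun v w => w \in [:: v; half_turn v]) D E ->
  knot_diagram D -> same_knot D E.
Proof.
suff main D0 : all2 (fun v w => w \in [:: v; half_turn v]) D E ->
    knot_diagram (D0 ++ D) -> same_knot (D0 ++ D) (D0 ++ E) by exact: (main [::]).
elim: D E D0 => [|v D IHD] [|w E] //= D0; first by move=> _ _; apply: rst_refl.
case/andP=> vw DE knotD.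
have permD u : perm_eq (D0 ++ u :: D) (u :: (D0 ++ D)).
  by rewrite -cat1s perm_catCA.
have knotD1 := knot_reorder (permD _) knotD.
have [knotE skE] : knot_diagram (D0 ++ w :: D) /\ same_knot (D0 ++ v :: D) (D0
  ++ w :: D).
  move: vw; rewrite !inE => /orP[]/eqP->; first by split=> //; apply: rst_refl.
  have knotE : knot_diagram (D0 ++ half_turn v :: D).
    by have := knot_half_turn knotD1; apply: knot_reorder; rewrite perm_sym.
  split=> //; apply: same_knot_trans (same_knot_reorder (permD _) knotD) _.
  apply: same_knot_trans (same_knot_half_turn knotD1) _.
  by apply: same_knot_sym; apply: same_knot_reorder.
apply: same_knot_trans skE _; rewrite -!cat_rcons in knotE *.
exact: IHD.
Qed.

Lemma crossings_perm (D E : diagram) : perm_eq D E -> crossings D = crossings E.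
Proof. by move=> /seq.permP eqDE; apply: eqDE. Qed.

(** Each absorption shortens the diagram. A point that cannot be absorbed has both ends on one edge,
    and by [knot_point_loop] it is then the whole diagram. *)
Lemma absorb_points (D : diagram) : knot_diagram D ->
  exists2 E, same_knot D E /\ crossings E = crossings D &
    all is_crossing E \/ exists a, E = [:: P a a].
Proof.
elim: {D}(size D) {-2}D (leqnn (size D)) => [|n IHn] D.
  by rewrite leqn0 size_eq0 => /eqP-> _; exists [::]; [split;
    first exact: rst_refl | left].
move=> leDn knotD; have [|] := boolP (all is_crossing D).
  by exists D; [split; first exact: rst_refl | left].
case/allPn=> -[//|a b] vD _; have permD := perm_to_rem vD.
have knotD' := knot_reorder permD knotD.
have skD := same_knot_reorder permD knotD.
have [eq_ab|neq_ab] := eqVneq a b.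
  rewrite -eq_ab in knotD' skD permD; have remD := knot_point_loop knotD'.
  rewrite remD in skD permD; exists [:: P a a]; last by right; exists a.
  by split; rewrite ?(crossings_perm permD).
have knotE := knot_absorb neq_ab knotD'.
have skE := same_knot_move knotD' knotE (absorb _ neq_ab).
have [|F [skF crF] caseF] := IHn _ _ knotE.
  by rewrite size_map -ltnS (leq_trans _ leDn) // (perm_size permD).
exists F => //; split; first exact: same_knot_trans skD (same_knot_trans skE skF).
rewrite crF (crossings_perm permD) /crossings count_map.
by apply: eq_count; case.
Qed.

(** * Colourings under Reidemeister moves *)

Local Open Scope ring_scope.

Definition colored (p : nat) (D : diagram) : Prop :=
  exists f : nat -> 'Z_p, fox_coloring D f /\ nontrivial_coloring D f.

Section ColoringMoves.
Variable p : nat.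
Implicit Types (f g : nat -> 'Z_p) (A B D E : diagram).

Lemma fox_coloring_eq D f g :
  {in edges D, f =1 g} -> fox_coloring D f -> fox_coloring D g.
Proof.
move=> eq_fg colf v vD; have eqv x : x \in edges_at v -> g x = f x.
  move=> xv; rewrite eq_fg //; apply/flattenP; exists (edges_at v) => //.
  exact: map_f.
case: v vD eqv => [a b c d|a b] /colf Hv eqv.
  by rewrite !eqv ?inE ?eqxx ?orbT.
by rewrite !eqv ?inE ?eqxx ?orbT.
Qed.

Lemma fox_coloring_cat A B f :
  fox_coloring (A ++ B) f <-> fox_coloring A f /\ fox_coloring B f.
Proof.
split=> [col|[colA colB] v]; last by rewrite mem_cat => /orP[/colA|/colB].
by split=> v vAB; apply: col; rewrite mem_cat vAB ?orbT.
Qed.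

Lemma edges_cat A B : edges (A ++ B) = edges A ++ edges B.
Proof. by rewrite /edges map_cat flatten_cat. Qed.

(** Works by contraposition: if [g] were constant, [f] would be constant with the same value.
    Keeping the value the same lets a replaced part and the untouched rest be treated separately in
    [colored_replace]. *)
Lemma nontrivial_transfer D E f g x0 :
  x0 \in edges E ->
  (forall c, {in edges E, forall x, g x = c} -> {in edges D, forall x, f x = c}) ->
  nontrivial_coloring D f -> nontrivial_coloring E g.
Proof.
move=> x0E gf [a [b [aD bD neq_ab]]]; apply: contrapT => trivE.
suff gE : {in edges E, forall x, g x = g x0} by apply: neq_ab; rewrite !(gf _ gE).
by move=> x xE; apply: contrapT => neq; apply: trivE; exists x, x0.
Qed.

Lemma colored_replace A B D x0 :
  x0 \in edges B ->
  (forall f, fox_coloring A f -> exists g, [/\ fox_coloring B g,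
     {in edges D, f =1 g} &
     forall c, {in edges B, forall x, g x = c} ->
       {in edges A, forall x, f x = c}]) ->
  colored p (A ++ D) -> colored p (B ++ D).
Proof.
move=> x0B AB [f [/fox_coloring_cat[colA colD]]]; have [g [colB eqD gB]] := AB f colA.
move=> nontriv; exists g; split.
  by apply/fox_coloring_cat; split=> //; apply: fox_coloring_eq colD.
apply: (nontrivial_transfer (x0 := x0)) nontriv.
  by rewrite edges_cat mem_cat x0B.
move=> c gc x; rewrite edges_cat mem_cat => /orP[xA|xD].
  by apply: gB xA => y yB; apply: gc; rewrite edges_cat mem_cat yB.
by rewrite eqD //; apply: gc; rewrite edges_cat mem_cat xD orbT.
Qed.

Lemma colored_same_nodes D E : D =i E -> edges D =i edges E ->
  colored p D -> colored p E.
Proof.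
move=> eqDE eqe [f [col [a [b [aD bD neq]]]]]; exists f; split.
  by move=> v; rewrite -eqDE; apply: col.
by exists a, b; rewrite -!eqe.
Qed.

Lemma colored_relabel h D : injective h ->
  colored p D <-> colored p (map (map_node h) D).
Proof.
move=> h_inj; split=> -[f [col nontriv]].
  have /choice[g gP] y : exists z, forall x, h x = y -> f x = z.
    have [[x <-]|no_x] := EM (exists x, h x = y).
      by exists (f x) => x' /h_inj->.
    by exists 0 => x hx; case: no_x; exists x.
  have {gP} gh x : g (h x) = f x by rewrite -(gP (h x) x).
  exists g; split.
    by move=> _ /mapP[v vD ->]; case: v vD => [a b c d|a b] /col /=; rewrite !gh.
  have [a [b [aD bD neq]]] := nontriv; exists (h a), (h b).
  by rewrite edges_map_node !map_f // !gh.
exists (f \o h); split.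
  move=> v vD; have := col _ (map_f (map_node h) vD).
  by case: v vD.
case: nontriv => a [b];
  rewrite edges_map_node => -[/mapP[a' a'D ->] /mapP[b' b'D ->] neq].
by exists a', b'.
Qed.

Lemma colored_absorb a b D : a != b -> edges_paired (P a b :: D) ->
  colored p (P a b :: D) <->
  colored p (map (map_node (fun x => if x == b then a else x)) D).
Proof.
set sub := fun x => _ => neq_ab pairD.
have aD : a \in edges D.
  rewrite -has_pred1 has_count; have := pairD a; rewrite /edges /= inE eqxx.
  by rewrite (eq_sym b) (negPf neq_ab); case: (count _ _) => // /(_ isT).
have sub_a : sub a = a by rewrite /sub (negPf neq_ab).
have sub_b : sub b = a by rewrite /sub eqxx.
split=> -[f [col nontriv]].
  have f_ab : f a = f b by have := col (P a b); rewrite inE eqxx; apply.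
  have f_sub x : f (sub x) = f x by rewrite /sub; case: eqP => // ->.
  exists f; split.
    move=> _ /mapP[v vD ->]; have := col v; rewrite inE vD orbT => /(_ isT).
    by case: v vD => [? ? ? ?|? ?] _ /=; rewrite !f_sub.
  apply: nontrivial_transfer nontriv.
    by rewrite edges_map_node; exact: map_f aD.
  rewrite edges_map_node => c fc x.
  have fD y : y \in edges D -> f y = c by move=> yD; rewrite -f_sub fc ?map_f.
  by rewrite /edges /= !inE => /or3P[/eqP->|/eqP->|/fD//]; rewrite -?f_ab fD.
exists (f \o sub); split.
  move=> v; rewrite inE => /orP[/eqP->|vD]; first by rewrite /= sub_a sub_b.
  have := col _ (map_f (map_node sub) vD).
  by case: v vD.
apply: (nontrivial_transfer (x0 := a)) nontriv; first by rewrite inE eqxx.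
move=> c fc x; rewrite edges_map_node => /mapP[y yD ->].
by apply: fc; rewrite /edges /= !inE yD !orbT.
Qed.

(** Gives the freshness of internal edges: both occurrences lie inside the replaced part, and
    pairing allows no third. *)
Lemma notin_double (T : eqType) (x : T) (s t u : seq T) :
  count_mem x (s ++ x :: t ++ x :: u) = 2%N -> x \notin s ++ t ++ u.
Proof.
rewrite !(count_cat, mem_cat) /= eqxx count_cat /= eqxx !negb_or => eq2.
move: eq2; rewrite !add1n !addnS => -[] /eqP; rewrite !addn_eq0.
by rewrite -!has_pred1 !has_count -!eqn0Ngt.
Qed.

(** At a kink the crossing relation reads 2 f x = f a + f x, so all edges of the kink share one
    colour. *)
Lemma colored_R1 a b x D : edges_paired (X a x x b :: D) ->
  colored p (X a x x b :: D) <-> colored p (P a b :: D).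
Proof.
move=> pairD; have : x \notin [:: a] ++ [::] ++ b :: edges D.
  by apply: notin_double; apply: pairD; rewrite !inE eqxx orbT.
rewrite !inE !negb_or => /and3P[xa xb xD].
split.
  apply: (@colored_replace [:: _] [:: _] D a); first by rewrite inE eqxx.
  move=> f /(_ _ (mem_head _ _)) [f_xb f_xx]; exists f.
  have f_xa : f x = f a by apply: (@addIr _ (f x)); rewrite -f_xx mulr_natl mulr2n.
  split=> // [v|c fc]; first by rewrite inE => /eqP->; rewrite -f_xa.
  have fa : f a = c by apply: fc; rewrite !inE eqxx.
  by move=> y; rewrite !inE => /or4P[]/eqP->; rewrite -?f_xb ?f_xa.
apply: (@colored_replace [:: _] [:: _] D a); first by rewrite inE eqxx.
move=> f /(_ _ (mem_head _ _)) f_ab.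
exists (fun y => if y == x then f a else f y); split.
- move=> v; rewrite inE => /eqP->; rewrite eqxx !(eq_sym _ x) (negPf xa) (negPf xb).
  by rewrite mulr_natl mulr2n.
- by move=> y yD; case: eqP yD => // ->; rewrite (negPf xD).
move=> c fc; have := fc a; rewrite (eq_sym a) (negPf xa) => fa.
by move=> y; rewrite !inE => /orP[]/eqP->; rewrite -?f_ab fa // !inE eqxx.
Qed.

Lemma colored_R1' a b x D : edges_paired (X a b x x :: D) ->
  colored p (X a b x x :: D) <-> colored p (P a b :: D).
Proof.
move=> pairD; have : x \notin [:: a; b] ++ [::] ++ edges D.
  by apply: notin_double; apply: pairD; rewrite !inE eqxx !orbT.
rewrite !inE !negb_or => /and3P[xa xb xD].
split.
  apply: (@colored_replace [:: _] [:: _] D a); first by rewrite inE eqxx.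
  move=> f /(_ _ (mem_head _ _)) [f_xb f_xx]; exists f.
  have f_xa : f x = f a.
    by apply: (@addIr _ (f x)); rewrite -f_xx mulr_natl mulr2n f_xb.
  split=> // [v|c fc]; first by rewrite inE => /eqP->; rewrite -f_xa f_xb.
  have fa : f a = c by apply: fc; rewrite !inE eqxx.
  by move=> y; rewrite !inE => /or4P[]/eqP->; rewrite ?f_xb ?f_xa.
apply: (@colored_replace [:: _] [:: _] D a); first by rewrite inE eqxx.
move=> f /(_ _ (mem_head _ _)) f_ab.
exists (fun y => if y == x then f a else f y); split.
- move=> v; rewrite inE => /eqP->; rewrite eqxx !(eq_sym _ x) (negPf xa) (negPf xb).
  by rewrite mulr_natl mulr2n f_ab.
- by move=> y yD; case: eqP yD => // ->; rewrite (negPf xD).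
move=> c fc; have := fc a; rewrite (eq_sym a) (negPf xa) => fa.
by move=> y; rewrite !inE => /orP[]/eqP->; rewrite -?f_ab fa // !inE eqxx.
Qed.

Lemma colored_R2 a b c d x y D :
  edges_paired [:: X c x y a, X y x d b & D] ->
  colored p [:: X c x y a, X y x d b & D] <-> colored p [:: P a b, P c d & D].
Proof.
move=> pairD; have : x \notin [:: c] ++ [:: y; a; y] ++ [:: d, b & edges D].
  by apply: notin_double; apply: pairD; rewrite !inE eqxx ?orbT.
rewrite !inE !negb_or => /and5P[xc xy xa _ /and3P[xd xb xD]].
have : y \notin [:: c; x] ++ [:: a] ++ [:: x, d, b & edges D].
  by apply: notin_double; apply: pairD; rewrite !inE eqxx ?orbT.
rewrite !inE !negb_or => /and5P[yc _ ya _ /and3P[yd yb yD]].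
split.
  apply: (@colored_replace [:: _; _] [:: _; _] D a); first by rewrite inE eqxx.
  move=> f col; have [f_xa f_cy] := col _ (mem_head _ _).
  have [f_xb f_yd] : f x = f b /\ 2%:R * f x = f y + f d.
    by apply: (col (X y x d b)); rewrite !inE eqxx orbT.
  have f_cd : f c = f d by apply: (@addIr _ (f y)); rewrite -f_cy f_yd addrC.
  exists f; split=> // [v|k fk].
    by rewrite !inE => /orP[]/eqP->; rewrite -?f_xa.
  have fa : f a = k by apply: fk; rewrite !inE eqxx.
  have fc : f c = k by apply: fk; rewrite !inE eqxx !orbT.
  have fy : f y = k.
    by apply: (@addrI _ (f c)); rewrite -f_cy f_xa fa fc mulr_natl mulr2n.
  have eq_k z : z \in [:: a; b; c; d; x; y] -> f z = k.
    by rewrite !inE => /or4P[|||/or3P[]]/eqP->; rewrite -?f_xb -?f_cd ?f_xa.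
  move=> z zA; apply: eq_k; move: zA; rewrite !inE.
  by case/or4P=> [|||/or4P[||| /orP[]]] /eqP->; rewrite eqxx ?orbT.
apply: (@colored_replace [:: _; _] [:: _; _] D c).
  by rewrite !inE eqxx.
move=> f col; have f_ab : f a = f b := col _ (mem_head _ _).
have f_cd : f c = f d by apply: (col (P c d)); rewrite !inE eqxx orbT.
(* The upper strand keeps its colour, and [y], which runs below it, takes the reflection of the
   colour of [c] in that colour. *)
pose g z := if z == x then f a else if z == y then 2%:R * f a - f c else f z.
have gx : g x = f a by rewrite /g eqxx.
have gy : g y = 2%:R * f a - f c by rewrite /g eq_sym (negPf xy) eqxx.
have gE z : z != x -> z != y -> g z = f z.
  by rewrite /g => /negPf-> /negPf->.
have gs z : z \in [:: a; b; c; d] -> g z = f z.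
  by rewrite !inE => /or4P[]/eqP->; apply: gE; rewrite eq_sym.
exists g; split.
- move=> v; rewrite !inE => /orP[]/eqP->;
  rewrite gx gy !gs ?inE ?eqxx ?orbT // -?f_ab -?f_cd.
    by rewrite subrKC.
  by rewrite subrK.
- move=> z zD; symmetry; apply: gE; first by apply: contraNneq xD => <-.
  by apply: contraNneq yD => <-.
move=> k gk z zB; rewrite -gs; last by move: zB; rewrite !inE.
apply: gk; move: zB; rewrite !inE.
by case/or4P=> /eqP->; rewrite eqxx ?orbT.
Qed.

(** [ext] is the boundary of the tangle and [int] its inside. Boundary colours must extend to the
    new inside; that a constant boundary forces a constant old inside keeps the colouring
    nontrivial. *)
Lemma colored_tangle A B D (ext int : seq nat) x0 :
  x0 \in ext -> edges A =i ext ++ int -> edges B =i ext ++ int ->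
  {in int, forall x, x \notin ext ++ edges D} ->
  (forall f, fox_coloring A f ->
     (exists2 g, fox_coloring B g & {in ext, g =1 f}) /\
     forall k, {in ext, forall x, f x = k} -> {in int, forall x, f x = k}) ->
  colored p (A ++ D) -> colored p (B ++ D).
Proof.
move=> x0ext eA eB fresh AB; apply: (@colored_replace A B D x0).
  by rewrite eB mem_cat x0ext.
move=> f /AB[[g colB g_ext] f_int].
pose h z := if z \in int then g z else f z.
have h_ext : {in ext, h =1 f}.
  by move=> z z_ext; rewrite /h; case: ifP => // /fresh; rewrite mem_cat z_ext.
exists h; split.
- apply: fox_coloring_eq colB => z; rewrite eB mem_cat => /orP[z_ext|z_int].
    by rewrite h_ext // g_ext.
  by rewrite /h z_int.
- by move=> z zD; rewrite /h; case: ifP => // /fresh; rewrite mem_cat zD orbT.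
move=> k hk; have fk : {in ext, forall x, f x = k}.
  by move=> x x_ext; rewrite -h_ext // hk // eB mem_cat x_ext.
by move=> x; rewrite eA mem_cat => /orP[/fk|/(f_int k fk)].
Qed.

Section R3.
Variables a0 a1 a2 a3 a4 a5 x0 x1 x2 : nat.
Let ext := [:: a0; a1; a2; a3; a4; a5].
Let int := [:: x0; x1; x2].

(** Colours are prescribed as lists of values because boundary names may coincide, and the
    distinctness of [x0], [x1], [x2] is only derived later from pairing. *)
Definition extends A B := forall f, fox_coloring A f -> exists y0 y1 y2,
  (forall g, [seq g i | i <- ext] = [seq f i | i <- ext] ->
     [seq g i | i <- int] = [:: y0; y1; y2] -> fox_coloring B g) /\
  forall k, [seq f i | i <- ext] = [:: k; k; k; k; k; k] ->
            [seq f i | i <- int] = [:: k; k; k].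

Lemma colored_extends A B D : extends A B ->
  perm_eq (edges A) (int ++ int ++ ext) -> perm_eq (edges B) (int ++ int ++ ext) ->
  edges_paired (A ++ D) -> colored p (A ++ D) -> colored p (B ++ D).
Proof.
move=> AB eA eB pairAD.
have pair x : x \in int -> count_mem x (int ++ int ++ ext ++ edges D) = 2%N.
  move=> x_int; have := pairAD x;
    rewrite edges_cat !count_cat (seq.permP eA) !count_cat.
  rewrite -!addnA; apply; rewrite mem_cat (perm_mem eA) mem_cat x_int.
  by [].
(* [int ++ int] alone contributes twice the multiplicity in [int], so a total of 2 leaves
   multiplicity one and no occurrence elsewhere. *)
have count_int x : x \in int -> count_mem x int = 1%N /\ x \notin ext ++ edges D.
  move=> x_int; have := pair x x_int; rewrite !count_cat addnA addnn.
  have : (0 < count_mem x int)%N by rewrite -has_count has_pred1.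
  rewrite -has_pred1 has_count -eqn0Ngt count_cat.
  by case: (count_mem x int) => [|[|c]] //= _ [] /eqP; rewrite ?doubleS.
have uniq_int : uniq int.
  apply/count_mem_uniq => x; have [/count_int[-> //]|] := boolP (x \in int).
  by move/count_memPn.
have mem_ext B' : perm_eq (edges B') (int ++ int ++ ext) -> edges B' =i ext ++ int.
  move=> eB' z; rewrite (perm_mem eB') !mem_cat orbA orbb orbC.
  by [].
apply: (@colored_tangle A B D ext int a0); rewrite ?mem_head //.
- exact: mem_ext.
- exact: mem_ext.
- by move=> x /count_int[].
move=> f /AB[y0 [y1 [y2 [colB f_int]]]]; split; last first.
  move=> k fk; have /f_int eq_k : [seq f i | i <- ext] = [:: k; k; k; k; k; k].
    by rewrite /= !fk // !inE eqxx ?orbT.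
  move=> x x_int; have /(nthP k)[i lti <-] : f x \in [seq f i | i <- int] by
    exact: map_f.
  rewrite eq_k in lti *; by move: i lti; do 3!case=> //.
exists (fun z => if z \in int then nth 0 [:: y0; y1; y2] (index z int) else f z).
  apply: colB; last first.
    have := uniq_int; rewrite /= !inE negb_or !(eq_sym x1 x0) !(eq_sym x2) !eqxx !orbT.
    by case/and3P=> /andP[/negPf-> /negPf->] /negPf-> _.
  apply/eq_in_map=> z z_ext; case: ifP => // /count_int[_].
  by rewrite mem_cat z_ext.
move=> z z_ext /=; case: ifP => // /count_int[_].
by rewrite mem_cat z_ext.
Qed.

(** The colours of [a0], [a1], [a2] determine all others. With r_x(y) = 2x - y, the bottom strand
    leaves with the same colour on both sides because r_a r_b = r_c r_a for c = r_a(b). *)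
Lemma colored_R3_bottom2 D :
  let A := [:: X a1 x0 x1 a0; X a2 a3 x2 x0; X a5 x1 x2 a4] in
  let B := [:: X a2 x1 x2 a1; X a4 x0 x1 a3; X a5 a0 x2 x0] in
  edges_paired (A ++ D) -> edges_paired (B ++ D) ->
  colored p (A ++ D) <-> colored p (B ++ D).
Proof.
move=> A B pairA pairB.
have eA : perm_eq (edges A) (int ++ int ++ ext).
  by apply/seq.permP=> q; rewrite /A /int /ext /edges /=; ring.
have eB : perm_eq (edges B) (int ++ int ++ ext).
  by apply/seq.permP=> q; rewrite /A /int /ext /edges /=; ring.
split; apply: colored_extends => //.
  move=> f col.
  have [f_x0 f_x1] : f x0 = f a0 /\ 2%:R * f x0 = f a1 + f x1.
    by apply: (col (X a1 x0 x1 a0)); rewrite !inE eqxx ?orbT.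
  have [f_a3 f_x2] : f a3 = f x0 /\ 2%:R * f a3 = f a2 + f x2.
    by apply: (col (X a2 a3 x2 x0)); rewrite !inE eqxx ?orbT.
  have [f_a4 f_a5] : f x1 = f a4 /\ 2%:R * f x1 = f a5 + f x2.
    by apply: (col (X a5 x1 x2 a4)); rewrite !inE eqxx ?orbT.
  have {}f_x1 : f x1 = 2%:R * f a0 - f a1 by rewrite -f_x0 f_x1; ring.
  have {}f_x2 : f x2 = 2%:R * f a0 - f a2 by rewrite -f_x0 -f_a3 f_x2; ring.
  have {}f_a5 : f a5 = 2%:R * f a0 - 2%:R * f a1 + f a2.
    by apply: (@addIr _ (f x2)); rewrite -f_a5 f_x1 f_x2; ring.
  have {}f_a4 : f a4 = 2%:R * f a0 - f a1 by rewrite -f_a4.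
  exists (f a0), (f a1), (2%:R * f a1 - f a2); split.
    move=> g /= [e0 e1 e2 e3 e4 e5] [y0 y1 y2] v.
    rewrite !inE => /or3P[]/eqP->;
      rewrite ?y0 ?y1 ?y2 ?e0 ?e1 ?e2 ?e3 ?e4 ?e5 ?f_a3 ?f_a4 ?f_a5 ?f_x0.
    + by split=> //; ring.
    + by split=> //; ring.
    + by split=> //; ring.
  by move=> k /= [e0 e1 e2 _ _ _]; rewrite f_x1 f_x2 f_x0 e0 e1 e2; congr [:: _;
    _; _]; ring.
move=> f col.
have [f_x1 f_x2] : f x1 = f a1 /\ 2%:R * f x1 = f a2 + f x2.
  by apply: (col (X a2 x1 x2 a1)); rewrite !inE eqxx ?orbT.
have [f_a3 f_a4] : f x0 = f a3 /\ 2%:R * f x0 = f a4 + f x1.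
  by apply: (col (X a4 x0 x1 a3)); rewrite !inE eqxx ?orbT.
have [f_x0 f_a5] : f a0 = f x0 /\ 2%:R * f a0 = f a5 + f x2.
  by apply: (col (X a5 a0 x2 x0)); rewrite !inE eqxx ?orbT.
have {}f_a3 : f a3 = f a0 by rewrite f_x0.
have {}f_a4 : f a4 = 2%:R * f a0 - f a1 by rewrite f_x0 f_a4 f_x1; ring.
have {}f_x2 : f x2 = 2%:R * f a1 - f a2 by rewrite -f_x1 f_x2; ring.
have {}f_a5 : f a5 = 2%:R * f a0 - 2%:R * f a1 + f a2 by rewrite f_a5 f_x2; ring.
exists (f a0), (2%:R * f a0 - f a1), (2%:R * f a0 - f a2); split.
  move=> g /= [e0 e1 e2 e3 e4 e5] [y0 y1 y2] v.
  rewrite !inE => /or3P[]/eqP->;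
    rewrite ?y0 ?y1 ?y2 ?e0 ?e1 ?e2 ?e3 ?e4 ?e5 ?f_a3 ?f_a4 ?f_a5.
  + by split=> //; ring.
  + by split=> //; ring.
  + by split=> //; ring.
by move=> k /= [e0 e1 e2 _ _ _]; rewrite f_x1 f_x2 -f_x0 e0 e1 e2; congr [:: _;
  _; _]; ring.
Qed.

Lemma colored_R3_bottom1 D :
  let A := [:: X a1 x0 x1 a0; X a2 a3 x2 x0; X a4 a5 x1 x2] in
  let B := [:: X a1 a2 x1 x2; X a4 x0 x1 a3; X a5 a0 x2 x0] in
  edges_paired (A ++ D) -> edges_paired (B ++ D) ->
  colored p (A ++ D) <-> colored p (B ++ D).
Proof.
move=> A B pairA pairB.
have eA : perm_eq (edges A) (int ++ int ++ ext).
  by apply/seq.permP=> q; rewrite /A /int /ext /edges /=; ring.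
have eB : perm_eq (edges B) (int ++ int ++ ext).
  by apply/seq.permP=> q; rewrite /A /int /ext /edges /=; ring.
split; apply: colored_extends => //.
  move=> f col.
  have [f_x0 f_x1] : f x0 = f a0 /\ 2%:R * f x0 = f a1 + f x1.
    by apply: (col (X a1 x0 x1 a0)); rewrite !inE eqxx ?orbT.
  have [f_a3 f_x2] : f a3 = f x0 /\ 2%:R * f a3 = f a2 + f x2.
    by apply: (col (X a2 a3 x2 x0)); rewrite !inE eqxx ?orbT.
  have [f_a5 f_a4] : f a5 = f x2 /\ 2%:R * f a5 = f a4 + f x1.
    by apply: (col (X a4 a5 x1 x2)); rewrite !inE eqxx ?orbT.
  have {}f_x1 : f x1 = 2%:R * f a0 - f a1 by rewrite -f_x0 f_x1; ring.
  have {}f_x2 : f x2 = 2%:R * f a0 - f a2 by rewrite -f_x0 -f_a3 f_x2; ring.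
  have {}f_a4 : f a4 = 2%:R * f a0 - 2%:R * f a2 + f a1.
    by apply: (@addIr _ (f x1)); rewrite -f_a4 f_a5 f_x1 f_x2; ring.
  exists (f a0), (2%:R * f a2 - f a1), (f a2); split.
    move=> g /= [e0 e1 e2 e3 e4 e5] [y0 y1 y2] v.
    rewrite !inE => /or3P[]/eqP->;
      rewrite ?y0 ?y1 ?y2 ?e0 ?e1 ?e2 ?e3 ?e4 ?e5 ?f_a3 ?f_a4 ?f_a5 ?f_x2 ?f_x0.
    + by split=> //; ring.
    + by split=> //; ring.
    + by split=> //; ring.
  by move=> k /= [e0 e1 e2 _ _ _]; rewrite f_x1 f_x2 f_x0 e0 e1 e2; congr [:: _;
    _; _]; ring.
move=> f col.
have [f_x2 f_x1] : f a2 = f x2 /\ 2%:R * f a2 = f a1 + f x1.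
  by apply: (col (X a1 a2 x1 x2)); rewrite !inE eqxx ?orbT.
have [f_a3 f_a4] : f x0 = f a3 /\ 2%:R * f x0 = f a4 + f x1.
  by apply: (col (X a4 x0 x1 a3)); rewrite !inE eqxx ?orbT.
have [f_x0 f_a5] : f a0 = f x0 /\ 2%:R * f a0 = f a5 + f x2.
  by apply: (col (X a5 a0 x2 x0)); rewrite !inE eqxx ?orbT.
have {}f_a3 : f a3 = f a0 by rewrite f_x0.
have {}f_x1 : f x1 = 2%:R * f a2 - f a1 by rewrite f_x1; ring.
have {}f_a4 : f a4 = 2%:R * f a0 - 2%:R * f a2 + f a1.
  by apply: (@addIr _ (f x1)); rewrite -f_a4 -f_x0 f_x1; ring.
have {}f_a5 : f a5 = 2%:R * f a0 - f a2 by rewrite f_a5 f_x2; ring.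
exists (f a0), (2%:R * f a0 - f a1), (2%:R * f a0 - f a2); split.
  move=> g /= [e0 e1 e2 e3 e4 e5] [y0 y1 y2] v.
  rewrite !inE => /or3P[]/eqP->;
    rewrite ?y0 ?y1 ?y2 ?e0 ?e1 ?e2 ?e3 ?e4 ?e5 ?f_a3 ?f_a4 ?f_a5.
  + by split=> //; ring.
  + by split=> //; ring.
  + by split=> //; ring.
by move=> k /= [e0 e1 e2 _ _ _]; rewrite f_x1 -f_x2 -f_x0 e0 e1 e2; congr [:: _;
  _; _]; ring.
Qed.

End R3.

Lemma colored_move D E : knot_move D E -> colored p D <-> colored p E.
Proof.
case=> /knot_paired pairD /knot_paired pairE DE; case: DE pairD pairE => {D E}.
- move=> D E DE _ _; have eqe := perm_mem (perm_edges DE).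
  by split; apply: colored_same_nodes => x; rewrite ?eqe ?(perm_mem DE).
- by move=> f D f_inj _ _; apply: colored_relabel.
- move=> a b c d D _ _.
  have turn a' b' c' d' : colored p (X a' b' c' d' :: D) -> colored p (X c' d'
    a' b' :: D).
    case=> f [col [x [y [xD yD neq]]]]; exists f; split.
      move=> v; rewrite inE => /orP[/eqP->|vD]; last by apply: col; rewrite inE vD orbT.
      have [f_bd f_ac] := col _ (mem_head _ _); rewrite -f_bd f_ac; split=> //.
      exact: addrC.
    have eqe : edges (X a' b' c' d' :: D) =i edges (X c' d' a' b' :: D).
      by move=> z; rewrite !inE; case: (z == a'); case: (z == b'); case: (z == c');
        case: (z == d').
    by exists x, y; rewrite -!eqe.
  by split; apply: turn.
- move=> a b D _ _.
  have turn a' b' : colored p (P a' b' :: D) -> colored p (P b' a' :: D).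
    case=> f [col [x [y [xD yD neq]]]]; exists f; split.
      move=> v; rewrite inE => /orP[/eqP->|vD]; last by apply: col; rewrite inE vD orbT.
      by have f_ab := col _ (mem_head _ _); rewrite /= f_ab.
    have eqe : edges (P a' b' :: D) =i edges (P b' a' :: D).
      by move=> z; rewrite !inE; case: (z == a'); case: (z == b').
    by exists x, y; rewrite -!eqe.
  by split; apply: turn.
- by move=> a b D neq pairD _; apply: colored_absorb.
- by move=> a b x D pairD _; apply: colored_R1.
- by move=> a b x D pairD _; apply: colored_R1'.
- by move=> a b c d x y D pairD _; apply: colored_R2.
- by move=> *; apply: colored_R3_bottom2.
- by move=> *; apply: colored_R3_bottom1.
Qed.

Lemma colored_same_knot D E : same_knot D E -> colored p D <-> colored p E.
Proof.
elim=> {D E} [D E /colored_move //|//|D E _ [? ?]|D E F _ [? ?] _ [? ?]].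
  by split.
by split; auto.
Qed.

End ColoringMoves.

(** * Determinants of sums of two incidence matrices *)

Lemma det_singular (R : idomainType) n (A : 'M[R]_n) (v : 'cV_n) :
  v != 0 -> A *m v = 0 -> \det A = 0.
Proof.
move=> v0 Av; rewrite -det_tr; apply/eqP/det0P; exists v^T.
  by rewrite -trmx0 (inj_eq trmx_inj).
by rewrite -trmx_mul Av trmx0.
Qed.

(** A row of the incidence matrix of a directed graph; [None] stands for an endpoint whose column
    has been deleted. *)
Definition arc_row (n : nat) (v : 'rV[int]_n) : Prop :=
  exists a b : option 'I_n,
    forall j, v 0 j = (a == Some j)%:R - (b == Some j)%:R.

(** Total unimodularity of incidence matrices. A row with at most one nonzero entry allows
    expansion; if there is none, every row has both endpoints among the columns, so row sums vanish
    and the constant vector is in the kernel. *)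
Lemma det_arc_rows n (A : 'M[int]_n) :
  (forall i, arc_row (row i A)) -> `|\det A| <= 1.
Proof.
elim: n A => [|n IHn] A arcA; first by rewrite det_mx00 normr1.
pose monic_row i := exists j s, (forall j', A i j' = s * (j' == j)%:R) /\ `|s| <= 1.
have [[i [j [s [rowA s_le1]]]]|no_monic] := EM (exists i, monic_row i).
  rewrite (expand_det_row _ i) (bigD1 j) //= big1 => [|j' /negPf neq_j]; last first.
    by rewrite rowA neq_j mulr0 mul0r.
  rewrite addr0 rowA eqxx mulr1 /cofactor !normrM normrX normrN1 expr1n mul1r.
  rewrite mulr_ile1 // IHn // => k; have [a [b rowk]] := arcA (lift i k).
  (* Deleting column [j] turns an endpoint [j] into [None]. *)
  exists (obind (unlift j) a), (obind (unlift j) b) => j'; rewrite !mxE.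
  have := rowk (lift j j'); rewrite mxE => ->.
  suff eq_unlift c : (c == Some (lift j j')) = (obind (unlift j) c == Some j').
    by rewrite !eq_unlift.
  case: c => //= c; case: unliftP => [c' ->|->] /=.
    by rewrite -[LHS]/(lift j c' == lift j j') (inj_eq (@lift_inj _ _)).
  by rewrite -[LHS]/(j == lift j j') (negPf (neq_lift _ _)).
rewrite (@det_singular _ _ _ (const_mx 1)) ?normr0 //.
  by apply/eqP=> /matrixP/(_ 0 0)/eqP; rewrite !mxE oner_eq0.
apply/matrixP=> i k; rewrite !mxE.
have [a [b rowi]] := arcA i.
have {}rowi j : A i j = (a == Some j)%:R - (b == Some j)%:R by rewrite -rowi mxE.
have [a' def_a] : exists a', a = Some a'.
  case def_a: a => [a'|]; first by exists a'.
  case: no_monic; exists i; rewrite /monic_row; case def_b: b => [b'|].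
    exists b', (-1); split=> // j; rewrite rowi def_a def_b /= sub0r mulN1r.
    by rewrite eq_sym.
  by exists 0, 0; split=> // j; rewrite rowi def_a def_b mul0r subrr.
have [b' def_b] : exists b', b = Some b'.
  case def_b: b => [b'|]; first by exists b'.
  case: no_monic; exists i, a', 1; split=> // j; rewrite rowi def_a def_b subr0 mul1r.
  by rewrite eq_sym.
rewrite (eq_bigr (fun j => (Some a' == Some j)%:R - (Some b' == Some j)%:R));
  last first.
  by move=> j _; rewrite mxE mulr1 rowi def_a def_b.
have sum1 c : \sum_j (Some c == Some j)%:R = 1 :> int.
  rewrite (bigD1 c) //= eqxx big1 ?addr0 // => j /negPf.
  by rewrite -[Some c == Some j]/(c == j) eq_sym => ->.
by rewrite sumrB !sum1 subrr.
Qed.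

(** * Expansion of a determinant over sets of rows, and the count of its nonzero terms *)

Section MixedDeterminant.
Variables (R : comPzRingType) (n : nat) (B W : 'M[R]_n) (J : {set 'I_n}).

Definition mixed (t : {set 'I_n}) : 'M[R]_n :=
  \matrix_(i, j) if i \in t then B i j else W i j.

Lemma det_add_mixed : \det (B + W) = \sum_t \det (mixed t).
Proof.
rewrite /determinant exchange_big /=; apply: eq_bigr => s _.
rewrite -big_distrr /=; congr (_ * _); transitivity (\prod_i (B i (s i) + W i (s i))).
  by apply: eq_bigr => i _; rewrite mxE.
rewrite bigA_distr; apply: eq_bigr => t _; apply: eq_bigr => i _.
by rewrite mxE.
Qed.

Hypothesis B_J : forall i j, j \notin J -> B i j = 0.
Hypothesis W_J : forall i j, j \in J -> W i j = 0.

(* [mixed t] carries the projection onto [t] to the projection onto [J], so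
   their traces agree. *)
Lemma det_mixed_card t :
  \det (mixed t) * #|t|%:R = \det (mixed t) * #|J|%:R.
Proof.
pose proj (S : {set 'I_n}) : 'M[R]_n := diag_mx (\row_i (i \in S)%:R).
have tr_proj S : \tr (proj S) = #|S|%:R.
  rewrite mxtrace_diag -sum1_card natr_sum [RHS]big_mkcond /=.
  by apply: eq_bigr => i _; rewrite mxE; case: ifP.
have mixed_proj : mixed t *m proj J = proj t *m mixed t.
  apply/matrixP=> i j; rewrite mul_mx_diag mul_diag_mx !mxE.
  (* An entry of [mixed t] can be nonzero only if i lies in [t] exactly when j lies in [J]. *)
  case: (boolP (i \in t)) => it; case: (boolP (j \in J)) => jJ;
    by rewrite ?(B_J _ jJ) ?(W_J _ jJ) ?mulr1 ?mul1r ?mulr0 ?mul0r.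
have trE (S : {set 'I_n}) : \det (mixed t) * #|S|%:R = \tr ((\det (mixed t))%:M
  *m proj S).
  by rewrite mul_scalar_mx mxtraceZ tr_proj.
(* The adjugate replaces the inverse, which is why the determinant remains as a factor on both
   sides; cyclicity of the trace does the rest. *)
rewrite !trE -{2}mul_adj_mx -mulmxA mixed_proj -mul_mx_adj.
by rewrite [RHS]mxtrace_mulC [LHS]mxtrace_mulC !mulmxA.
Qed.

End MixedDeterminant.

Lemma mixedC (R : comPzRingType) n (B W : 'M[R]_n) t :
  mixed W B (~: t) = mixed B W t.
Proof. by apply/matrixP=> i j; rewrite !mxE inE; case: (i \in t). Qed.

Section BinaryPairs.
Variables (n : nat) (B W : 'M['F_2]_n) (J : {set 'I_n}).
Hypothesis B_J : forall i j, j \notin J -> B i j = 0.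
Hypothesis W_J : forall i j, j \in J -> W i j = 0.
Notation good t := (\det (mixed B W t) != 0).

(* The rows [B i], [i] in [Z], are tested against the plane of vectors killed
   by [mixed B W S]; there are only three nonzero vectors in a plane over the
   field with two elements. *)
Lemma four_bad_pair (S Z : {set 'I_n}) : [disjoint Z & S] -> #|Z| = 4%N ->
  exists i j, [/\ i \in Z, j \in Z, i != j & ~~ good (S :|: [set i; j])].
Proof.
move=> disjZS cardZ; apply: contrapT => no_bad.
have all_good i j : i \in Z -> j \in Z -> i != j -> good (S :|: [set i; j]).
  by move=> iZ jZ neq; apply: contraT => bad; case: no_bad; exists i, j.
have ZS i : i \in Z -> i \notin S by move=> iZ; rewrite (disjointFr disjZS iZ).
have [i0 i0Z] : exists i0, i0 \in Z by apply/card_gt0P; rewrite cardZ.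
have [j0 /setD1P[neq_ij0 j0Z]] : exists j0, j0 \in Z :\ i0.
  by apply/card_gt0P; move: cardZ; rewrite (cardsD1 i0) i0Z add1n => -[->].
pose M0 := mixed B W (S :|: [set i0; j0]).
have M0_unit : M0 \in unitmx.
  by rewrite unitmxE unitfE all_good // eq_sym.
(* Column [k] of the inverse of [M0], cut down to [J]: [W] then kills it, while on the rows of S and
   on i0, j0 the matrix [B] still sends it to the unit vector [k]. For k = i0, j0 these vectors span
   the plane. *)
pose a k : 'cV['F_2]_n := \col_j if j \in J then invmx M0 j k else 0.
have Wa i k : \sum_j W i j * a k j 0 = 0.
  by rewrite big1 // => j _; rewrite mxE; case: ifP => jJ;
    rewrite ?(W_J _ jJ) ?mul0r ?mulr0.
have Ba i k : i \in S :|: [set i0; j0] -> \sum_j B i j * a k j 0 = (i == k)%:R.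
  move=> iS; have := congr1 (fun M : 'M_n => M i k) (mulmxV M0_unit).
  rewrite !mxE => <-; apply: eq_bigr => j _; rewrite !mxE iS.
  by case: (boolP (j \in J)) => // jJ; rewrite (B_J _ jJ) !mul0r.
have Ba_S i k : i \in S -> k \in Z -> \sum_j B i j * a k j 0 = 0.
  move=> iS kZ; rewrite Ba ?inE ?iS //; case: eqP => // eq_ik.
  by have := ZS _ kZ; rewrite -eq_ik iS.
pose y i : 'F_2 * 'F_2 :=
  (\sum_j B i j * a i0 j 0, \sum_j B i j * a j0 j 0).
(* [y i] is the restriction of the row [B i] to the plane. If two rows vanish on a common nonzero
   vector of the plane, that vector lies in the kernel of the matrix mixed along S and {i, j},
   against [all_good]. *)
have kill i j c1 c2 : (c1, c2) != (0, 0) -> i \in Z -> j \in Z -> i != j ->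
    c1 * (y i).1 + c2 * (y i).2 = 0 -> c1 * (y j).1 + c2 * (y j).2 = 0 -> False.
  move=> c_neq0 iZ jZ neq yi yj; have /negP[] := all_good _ _ iZ jZ neq; apply/eqP.
  pose v := c1 *: a i0 + c2 *: a j0.
  have v_k k : v k 0 = c1 * a i0 k 0 + c2 * a j0 k 0 by rewrite !mxE.
  have Bv i' : \sum_k B i' k * v k 0 = c1 * (y i').1 + c2 * (y i').2.
    rewrite !mulr_sumr -big_split; apply: eq_bigr => k _.
    by rewrite v_k mulrDr [in RHS]mulrCA [X in _ + X]mulrCA.
  have Wv i' : \sum_k W i' k * v k 0 = 0.
    transitivity (c1 * (\sum_k W i' k * a i0 k 0) + c2 * (\sum_k W i' k * a j0 k 0)).
      rewrite !mulr_sumr -big_split; apply: eq_bigr => k _.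
      by rewrite v_k mulrDr [in RHS]mulrCA [X in _ + X]mulrCA.
    by rewrite !Wa !mulr0 addr0.
  have y_i0 : y i0 = (1, 0) by rewrite /y !Ba ?inE ?eqxx ?orbT // eq_sym (negPf
    neq_ij0).
  have y_j0 : y j0 = (0, 1) by rewrite /y !Ba ?inE ?eqxx ?orbT // (negPf neq_ij0).
  apply: (@det_singular _ _ _ v).
    apply: contraNneq c_neq0 => v0.
    have vB (k : 'I_n) : \sum_j B k j * v j 0 = 0.
      by rewrite big1 // => l _; rewrite v0 mxE mulr0.
    have := vB i0; have := vB j0; rewrite !Bv y_i0 y_j0 /=.
    by rewrite !mulr0 !mulr1 add0r addr0 => -> ->.
  apply/matrixP=> i' k'; rewrite !mxE (ord1 k').
  under eq_bigr do rewrite mxE.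
  have [|i'_t] := boolP (i' \in S :|: [set i; j]); last by rewrite Wv.
  rewrite Bv in_setU => /orP[iS|/set2P[->|->] //].
  by rewrite /y !Ba_S // !mulr0 addr0.
have orth (z : 'F_2 * 'F_2) : exists c1 c2, (c1, c2) != (0, 0) /\ c1 * z.1 + c2
  * z.2 = 0.
  case: z => z1 z2 /=; have [/eqP[-> ->]|z_neq0] := boolP ((z1, z2) == (0, 0)).
    by exists 1, 0; rewrite !mulr0 addr0.
  exists z2, (- z1); split; last by rewrite mulNr mulrC subrr.
  by apply: contra z_neq0; rewrite !xpair_eqE oppr_eq0 andbC.
have y_inj : {in Z &, injective y}.
  move=> i j iZ jZ eq_y; apply/eqP/contraT => neq.
  have [c1 [c2 [c_neq0 c_y]]] := orth (y i).
  by case: (kill i j c1 c2); rewrite // -eq_y.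
have y_neq0 i : i \in Z -> y i != (0, 0).
  move=> iZ; apply/eqP => y0.
  have [j /setD1P[neq jZ]] : exists j, j \in Z :\ i.
    by apply/card_gt0P; move: cardZ; rewrite (cardsD1 i) iZ add1n => -[->].
  have [c1 [c2 [c_neq0 c_y]]] := orth (y j).
  by case: (kill i j c1 c2); rewrite // ?y0 /= ?mulr0 ?addr0 // eq_sym.
have : (#|y @: Z| <= #|[set~ ((0%R, 0%R) : 'F_2 * 'F_2)]|)%N.
  by apply/subset_leq_card/subsetP=> _ /imsetP[i iZ ->]; rewrite !inE y_neq0.
rewrite card_in_imset // cardZ cardsC1 card_prod card_Fp //.
Qed.
End BinaryPairs.

(** Two of the ten pairs are excluded: the second four-element set omits the point [i] of the first
    bad pair, so it yields a different one. *)
Lemma pairs_of_five (T : finType) (Y : {set T}) (P : {set {set T}}) :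
  #|Y| = 5%N -> (forall X : {set T}, X \in P -> X \subset Y /\ #|X| = 2%N) ->
  (forall Z : {set T}, Z \subset Y -> #|Z| = 4%N ->
     exists i j, [/\ i \in Z, j \in Z, i != j & [set i; j] \notin P]) ->
  (#|P| <= 8)%N.
Proof.
move=> cardY P_pairs bad.
have card4 x : x \in Y -> #|Y :\ x| = 4%N.
  by move=> xY; move: cardY; rewrite (cardsD1 x) xY add1n => -[].
have [x0 x0Y] : exists x, x \in Y by apply/card_gt0P; rewrite cardY.
have [i [j [iZ jZ neq1 bad1]]] := bad _ (subsetDl Y [set x0]) (card4 _ x0Y).
have iY : i \in Y by case/setD1P: iZ.
have jY : j \in Y by case/setD1P: jZ.
have [k [l [kZ lZ neq2 bad2]]] := bad _ (subsetDl Y [set i]) (card4 _ iY).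
have kY : k \in Y by case/setD1P: kZ.
have lY : l \in Y by case/setD1P: lZ.
have neq12 : [set i; j] != [set k; l].
  apply/eqP=> /setP/(_ i); rewrite !inE eqxx => /esym.
  by case/setD1P: kZ => /negPf; rewrite eq_sym => -> _;
    case/setD1P: lZ => /negPf; rewrite eq_sym => ->.
pose E := [set X : {set T} | X \subset Y & #|X| == 2].
have : P :|: [set [set i; j]; [set k; l]] \subset E.
  apply/subsetP=> X; rewrite !inE => /orP[/P_pairs[-> ->]//|/orP[]/eqP->].
    by rewrite cards2 neq1 subUset !sub1set iY jY.
  by rewrite cards2 neq2 subUset !sub1set kY lY.
move/subset_leq_card; rewrite cards_draws cardY cardsU cards2 neq12.
have -> : P :&: [set [set i; j]; [set k; l]] = set0.
  apply/setP=> X; rewrite !inE; apply/negP=> /andP[XP /orP[]/eqP eqX].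
    by rewrite -eqX XP in bad1.
  by rewrite -eqX XP in bad2.
by rewrite cards0 subn0 -[X in (_ <= X)%N]/(8 + 2)%N leq_add2r.
Qed.

Lemma bin5_le8 r : r != 2%N -> r != 3%N -> ('C(5, r) <= 8)%N.
Proof. by case: r => [|[|[|[|[|[|r]]]]]]. Qed.

Section DeterminantBound.
Variables (n : nat) (B W : 'M[int]_n) (J : {set 'I_n}).
Hypothesis arc_B : forall i, arc_row (row i B).
Hypothesis arc_W : forall i, arc_row (row i W).
Hypothesis B_J : forall i j, j \notin J -> B i j = 0.
Hypothesis W_J : forall i j, j \in J -> W i j = 0.

Let G := [set t | \det (mixed B W t) != 0].

Lemma det_mixed_le1 t : `|\det (mixed B W t)| <= 1.
Proof.
apply: det_arc_rows => i; case: (boolP (i \in t)) => it.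
  by have [a [b rowi]] := arc_B i; exists a, b => j; rewrite -rowi !mxE it.
by have [a [b rowi]] := arc_W i; exists a, b => j; rewrite -rowi !mxE (negPf it).
Qed.

Lemma det_le_card : `|\det (B + W)| <= #|G|%:R.
Proof.
rewrite det_add_mixed (le_trans (ler_norm_sum _ _ _)) //.
rewrite -sum1_card natr_sum [leRHS]big_mkcond; apply: ler_sum => t _.
rewrite inE; case: eqP => [->|_]; first by rewrite normr0.
exact: det_mixed_le1.
Qed.

Lemma card_good t : t \in G -> #|t| = #|J|.
Proof.
rewrite inE => good_t; have := det_mixed_card B_J W_J t.
by move/(mulfI good_t)/eqP; rewrite eqr_nat => /eqP.
Qed.

Lemma card_good_bin : (#|G| <= 'C(n, #|J|))%N.
Proof.
rewrite -[n in 'C(n, _)]card_ord -card_draws subset_leq_card //.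
by apply/subsetP=> t /card_good; rewrite inE => ->.
Qed.

Let B2 : 'M['F_2]_n := map_mx intr B.
Let W2 : 'M['F_2]_n := map_mx intr W.

(** The integer determinant is 1 or -1 by [det_mixed_le1], hence odd. *)
Lemma good_mod2 t : t \in G -> \det (mixed B2 W2 t) != 0.
Proof.
rewrite inE => good_t.
have -> : mixed B2 W2 t = map_mx intr (mixed B W t).
  by apply/matrixP=> i j; rewrite !mxE; case: ifP.
rewrite det_map_mx; have := det_mixed_le1 t; move: good_t.
by case: (\det _) => [[|[|k]]|[|k]].
Qed.

(** All good sets with the same part [u] outside [Y] meet [Y] in equally many elements, r. For r = 2
    the traces on [Y] are fed to [pairs_of_five], for r = 3 their complements in [Y], with [B] and
    [W] exchanged; other values of r are covered by [bin5_le8]. *)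
Lemma card_good_fibre (Y u : {set 'I_n}) : #|Y| = 5%N ->
  (#|[set t in G | t :\: Y == u]| <= 8)%N.
Proof.
move=> cardY; set Gu := [set t in G | _].
have Gu_eq t : t \in Gu -> t = u :|: (t :&: Y).
  by rewrite inE => /andP[_ /eqP <-]; rewrite setUC setID.
have Gu_G t : t \in Gu -> t \in G by rewrite inE => /andP[].
have [->|[t0 t0_Gu]] := set_0Vmem Gu; first by rewrite cards0.
have disjYu : [disjoint Y & u].
  move: t0_Gu; rewrite inE => /andP[_ /eqP <-].
  by rewrite disjoints_subset setCD subsetUr.
have card_u t : t \in Gu -> (#|u| + #|t :&: Y| = #|J|)%N.
  move=> tGu; rewrite -(card_good (Gu_G _ tGu)) -(cardsID Y t) addnC.
  by move: tGu; rewrite inE => /andP[_ /eqP ->].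
have B2_J i j : j \notin J -> B2 i j = 0 by move=> jJ; rewrite mxE B_J.
have W2_J i j : j \in J -> W2 i j = 0 by move=> jJ; rewrite mxE W_J.
pose r := (#|J| - #|u|)%N.
have card_r t : t \in Gu -> #|t :&: Y| = r.
  by move=> /card_u; rewrite /r => <-; rewrite addKn.
have [r2|r_neq2] := eqVneq r 2%N.
  have inj : {in Gu &, injective (fun t => t :&: Y)}.
    by move=> t t' /Gu_eq def_t /Gu_eq def_t' eq_tt'; rewrite def_t def_t' eq_tt'.
  rewrite -(card_in_imset inj); apply: (pairs_of_five cardY) => [X|Z ZY cardZ].
    by case/imsetP=> t tGu ->; rewrite subsetIr card_r.
  have disjZu : [disjoint Z & u] by apply: disjointWl disjYu.
  have [i [j [iZ jZ neq bad]]] := four_bad_pair B2_J W2_J disjZu cardZ.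
  exists i, j; split=> //; apply: contra bad => /imsetP[t tGu ->].
  by rewrite -(Gu_eq t tGu); apply/good_mod2/Gu_G.
have [r3|r_neq3] := eqVneq r 3%N.
  have inj : {in Gu &, injective (fun t => Y :\: t)}.
    move=> t t' /Gu_eq def_t /Gu_eq def_t' /= eq_tt'; rewrite def_t def_t'.
    congr (_ :|: _); apply/setP=> x; rewrite !inE.
    have := congr1 (fun A : {set 'I_n} => x \in A) eq_tt'; rewrite !inE.
    by case: (x \in Y); rewrite ?andbF ?andbT // => /negb_inj.
  rewrite -(card_in_imset inj); apply: (pairs_of_five cardY) => [X|Z ZY cardZ].
    case/imsetP=> t tGu ->; rewrite subsetDl; split=> //.
    by rewrite cardsD setIC card_r // cardY r3.
  (* The rows outside [Y] that a set of this fibre takes from [W]; in the exchanged picture they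
     play the role that [u] had for r = 2. *)
  pose S := ~: (Y :|: u).
  have disjZS : [disjoint Z & S].
    by apply: disjointWl ZY _; rewrite disjoints_subset setCK subsetUl.
  have [||i [j [iZ jZ neq bad]]] := @four_bad_pair _ W2 B2 (~: J) _ _ S Z disjZS cardZ.
  - by move=> i j; rewrite inE negbK; apply: W2_J.
  - by move=> i j; rewrite inE; apply: B2_J.
  exists i, j; split=> //; apply: contra bad => /imsetP[t tGu eq_t].
  suff -> : S :|: [set i; j] = ~: t by rewrite mixedC; apply/good_mod2/Gu_G.
  rewrite eq_t; apply/setP=> x; rewrite [in RHS](Gu_eq t tGu) !inE.
  have := disjointFr disjYu (x := x).
  by case: (x \in Y) => [-> //|_]; rewrite ?andbF ?orbF ?andbT.
have inj : {in Gu &, injective (fun t => t :&: Y)}.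
  by move=> t t' /Gu_eq def_t /Gu_eq def_t' eq_tt'; rewrite def_t def_t' eq_tt'.
rewrite -(card_in_imset inj); apply: leq_trans (bin5_le8 r_neq2 r_neq3).
rewrite -cardY -cards_draws subset_leq_card //.
by apply/subsetP=> _ /imsetP[t tGu ->]; rewrite inE subsetIr card_r /=.
Qed.

(** There are 2^(n-5) possible parts outside the five rows of [Y], with at most 2^3 good sets for
    each. *)
Lemma card_good_pow2 : (5 <= n)%N -> (#|G| <= 2 ^ (n - 2))%N.
Proof.
move=> n_ge5; pose Y := [set widen_ord n_ge5 i | i : 'I_5].
have cardY : #|Y| = 5%N.
  by rewrite card_imset ?card_ord // => i j [] /val_inj.
rewrite -sum1_card (partition_big (fun t => t :\: Y) (mem (powerset (~: Y)))) /=.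
  apply: (@leq_trans (\sum_(u in powerset (~: Y)) 8)%N).
    apply: leq_sum => u _; apply: leq_trans (card_good_fibre u cardY).
    rewrite -sum1_card; apply: eq_leq; apply: eq_bigl => t.
    by rewrite [in RHS]inE.
  rewrite sum_nat_const card_powerset cardsCs setCK cardY card_ord.
  rewrite -[8%N]/(2 ^ 3)%N -expnD leq_exp2l //.
  by rewrite -(subnK n_ge5) addnK -addnBA.
by move=> t _; rewrite powersetE subsetDr.
Qed.

End DeterminantBound.

(** * Colourings of the faces *)

(** Numbers the cycles of [f], so that faces and edges can index rows and columns of matrices. *)
Lemma orbit_index (T : finType) (f : T -> T) m :
  injective f -> fcard f T = m ->
  exists phi : T -> 'I_m,
    (forall x y, (phi x == phi y) = fconnect f x y) /\
    forall j, exists x, phi x = j.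
Proof.
move=> f_inj <-; have sym := fconnect_sym f_inj.
have /choice[phi phiP] x : exists j : 'I_(fcard f T), enum_val j = froot f x.
  have rx : froot f x \in [predI froots f & T] by rewrite !inE andbT roots_root.
  by exists (enum_rank_in rx (froot f x)); rewrite enum_rankK_in.
exists phi; split=> [x y|j].
  by rewrite -(root_connect sym) -!phiP (inj_eq enum_val_inj).
exists (enum_val j); apply: enum_val_inj; rewrite phiP.
by have := enum_valP j; rewrite !inE andbT => /eqP.
Qed.

(** Evaluation at [i0] is injective on the left kernel, whose dimension is therefore at most one. *)
Lemma rank_kernel_point (F : fieldType) m q (A : 'M[F]_(m, q)) i0 :
  (forall u : 'rV_m, u *m A = 0 -> u 0 i0 = 0 -> u = 0) -> (m <= \rank A + 1)%N.
Proof.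
move=> inj; have := mxrank_mul_ker (kermx A) (delta_mx i0 0 : 'cV_m).
rewrite mxrank_ker; set I := (_ :&: _)%MS; have -> : I = 0.
  apply/row_matrixP=> i; rewrite row0; apply: inj.
    by apply/sub_kermxP; apply: submx_trans (row_sub _ _) (capmxSl _ _).
  have /sub_kermxP : (row i I <= kermx (delta_mx i0 0 : 'cV_m))%MS.
    by apply: submx_trans (row_sub _ _) (capmxSr _ _).
  by rewrite -colE => /matrixP/(_ 0 0); rewrite !mxE.
rewrite mxrank0 addn0 => eq_rank; rewrite -leq_subLR -eq_rank.
exact: rank_leq_col.
Qed.

Section Faces.
Variables (D : diagram).
Hypotheses (knotD : knot_diagram D) (crossD : all is_crossing D).
Let pairD : edges_paired D := knot_paired knotD.
Notation dartD := (dart D).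
Notation N := (@next_ccw D).
Notation R := (@other_end D).

Lemma degree4 (d : dartD) : degree (tag d) = 4%N.
Proof.
rewrite degree_pos; have [lt1 _] := pos_valid d.
by have := allP crossD _ (mem_nth (P 0 0) lt1); case: (nth _ D _).
Qed.

Lemma next4 (d : dartD) : N (N (N (N d))) = d.
Proof.
apply: pos_inj; rewrite (pos_iter_next d 4) degree4 modnDr modn_small.
  by rewrite -surjective_pairing.
by have [_] := pos_valid d; rewrite -degree_pos degree4.
Qed.

Lemma straight_on4 (d : dartD) : straight_on d = N (N (R d)).
Proof. by rewrite /straight_on opposite_degree4 ?degree4. Qed.

(** [straight_on] is composed of [R] and [N], and by [two_orbits] it reaches every dart from [d0] or
    [R d0]. *)
Lemma dart_connected (Q : dartD -> Prop) d0 : Q d0 ->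
  (forall d, Q d -> Q (R d)) -> (forall d, Q d -> Q (N d)) -> forall d, Q d.
Proof.
move=> Q0 QR QN d; have iterQ m x : Q x -> Q (iter m (@straight_on D) x).
  by elim: m => //= m IHm /IHm Qm; rewrite straight_on4; apply/QN/QN/QR.
by have [] := two_orbits knotD d0 d => /iter_findex <-; apply: iterQ => //; apply: QR.
Qed.

(** Hence the two faces along the edge of [d] are those of [d] and of [N d]. *)
Lemma around_face_other (d : dartD) : around_face (R d) = N d.
Proof. by rewrite /around_face other_endK. Qed.

Lemma size_edges4 : size (edges D) = (4 * size D)%N.
Proof.
rewrite /edges size_flatten /shape -map_comp sumnE big_map.
rewrite (eq_big_seq (fun=> 4%N)) => [|v /(allP crossD)]; last by case: v.
by rewrite big_const_seq count_predT iter_addn addn0.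
Qed.

Lemma card_faces : fcard (@around_face D) dartD = (size D + 2)%N.
Proof.
have [_ _] := knotD; rewrite size_edges4 => sphere; apply: (@addnI (size D)).
by rewrite sphere addnA addnn -mul2n -[4%N]/(2 * 2)%N -mulnA mul2n doubleK.
Qed.

Lemma fconnect_other (x y : dartD) : fconnect R x y = (y == x) || (y == R x).
Proof.
apply/idP/orP=> [/iter_findex <-|[]/eqP->]; [|exact: connect0|exact: fconnect1].
elim: (findex _ _ _) => [|m [] /eqP IHm] /=; first by left.
  by right; rewrite IHm.
by left; rewrite IHm other_endK.
Qed.

Lemma card_edges : fcard R dartD = (2 * size D)%N.
Proof.
apply/eqP; rewrite -(eqn_pmul2r (m := 2)) // mulnAC -size_edges4 -card_dart.
apply/eqP.
apply: fcard_order_set => //; first exact: can_inj (other_endK pairD).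
apply/subsetP=> x _; rewrite inE /order.
rewrite (eq_card (B := pred2 x (R x))) => [|y]; last by rewrite !inE fconnect_other.
by rewrite card2 (eq_sym x) (other_end_neq pairD).
Qed.

Lemma big_node (V : nmodType) (h : dartD -> V) d :
  \sum_(x | tag x == tag d) h x = h d + h (N d) + h (N (N d)) + h (N (N (N d))).
Proof.
have posN m : pos (iter m N d) = ((pos d).1, ((pos d).2 + m) %% 4)%N.
  by rewrite pos_iter_next degree4.
have neqN m m' : (m < 4)%N -> (m' < m)%N -> iter m N d != iter m' N d.
  move=> m4 lt_m; apply/eqP=> /(congr1 (@pos D)); rewrite !posN => -[] /eqP.
  by rewrite eqn_modDl !modn_small ?(ltn_trans lt_m) // gtn_eqF.
rewrite (bigD1 d) //= -!addrA; congr (_ + _).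
rewrite (bigD1 (N d)) /=; last by rewrite eqxx (neqN 1 0).
congr (_ + _); rewrite (bigD1 (N (N d))) /=;
  last by rewrite eqxx (neqN 2 0) ?(neqN 2 1).
congr (_ + _); rewrite (bigD1 (N (N (N d)))) /=; last first.
  by rewrite eqxx (neqN 3 0) ?(neqN 3 1) ?(neqN 3 2).
rewrite big1 ?addr0 // => x /andP[/andP[/andP[/andP[/eqP tx x0] x1] x2] x3].
have [_ x_lt] := pos_valid x; have [_ d_lt] := pos_valid d.
have px : (pos x).1 = (pos d).1 by rewrite !posE /= tx.
rewrite -degree_pos degree4 in x_lt; rewrite -degree_pos degree4 in d_lt.
have : exists2 m, (m < 4)%N & x = iter m N d.
  exists (((pos x).2 + (4 - (pos d).2)) %% 4)%N; first by rewrite ltn_mod.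
  apply: pos_inj; rewrite posN -px modnDmr addnCA subnKC ?(ltnW d_lt) //.
  by rewrite modnDr modn_small // -surjective_pairing.
by case=> -[|[|[|[|m]]]] // _ eq_x; rewrite eq_x eqxx in x0 x1 x2 x3.
Qed.

Section FaceColoring.
Variables (F : fieldType) (f : dartD -> F).
Hypothesis f_other : forall x, f (R x) = f x.
Hypothesis f_node : forall x, f x - f (N x) + f (N (N x)) - f (N (N (N x))) = 0.

(* The face functions modulo those alternating around nodes have dimension
   (size D + 2) - 1, which is the dimension of the space of all functions [f]
   as above; both computations use that the diagram is connected. *)
Lemma face_coloring : exists g : dartD -> F,
  (forall x, g (around_face x) = g x) /\ forall x, f x = g x + g (N x).
Proof.
have [phi [phiP phi_onto]] := orbit_index (around_face_inj pairD) card_faces.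
have [eps [epsP eps_onto]] := orbit_index (can_inj (other_endK pairD)) card_edges.
have phi_face x : phi (around_face x) = phi x.
  by apply/eqP; rewrite eq_sym phiP fconnect1.
have eps_other x : eps (R x) = eps x.
  by apply/eqP; rewrite eq_sym epsP fconnect1.
have phi_other x : phi (R x) = phi (N x) by rewrite -around_face_other phi_face.
have big_edge (h : dartD -> F) x : \sum_(y | eps y == eps x) h y = h x + h (R x).
  rewrite (bigD1 x) //= (bigD1 (R x)) /=; last by rewrite eps_other eqxx other_end_neq.
  rewrite big1 ?addr0 // => y /andP[/andP[eq_e /negPf y_x] /negPf y_Rx].
  by rewrite eq_sym epsP fconnect_other y_x y_Rx in eq_e.
pose sgn (x : dartD) : F := (-1) ^+ (pos x).2.
have sgn_next x : sgn (N x) = - sgn x.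
  have [_] := pos_valid x; rewrite -degree_pos degree4 /sgn pos_next degree4 /=.
  by case: (pos x).2 => [|[|[|[|k]]]] // _;
    rewrite -signr_odd -[in RHS]signr_odd /= ?opprK.
(* [A] turns a face function into the sums over the two sides of each edge, and [L] turns an edge
   function into its alternating sums at the nodes, up to sign. The goal is that the image of [A]
   fills the kernel of [L]. *)
pose A : 'M[F]_(size D + 2, 2 * size D) :=
  \matrix_(j, e) \sum_(x | eps x == e) (phi x == j)%:R.
pose L : 'M[F]_(2 * size D, size D) :=
  \matrix_(e, v) \sum_(x | (eps x == e) && (tag x == v)) sgn x.
have A_mul (g : 'rV[F]_(size D + 2)) x :
    (g *m A) 0 (eps x) = g 0 (phi x) + g 0 (phi (N x)).
  rewrite -phi_other -(big_edge (fun y => g 0 (phi y)) x) mxE.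
  under eq_bigr do rewrite mxE mulr_sumr.
  rewrite exchange_big; apply: eq_bigr => y _ /=.
  rewrite (bigD1 (phi y)) //= eqxx mulr1 big1 ?addr0 // => j /negPf.
  by rewrite eq_sym => ->; rewrite mulr0.
have L_mul (u : 'rV[F]_(2 * size D)) (d : dartD) : (u *m L) 0 (tag d) =
    sgn d * (u 0 (eps d) - u 0 (eps (N d)) + u 0 (eps (N (N d))) - u 0 (eps (N
      (N (N d))))).
  transitivity (\sum_(x | tag x == tag d) sgn x * u 0 (eps x)); last first.
    by rewrite big_node !sgn_next; ring.
  rewrite mxE; under eq_bigr do rewrite mxE mulr_sumr.
  rewrite (exchange_big_dep (fun x => tag x == tag d)) /=; last by move=> e x _ /andP[].
  apply: eq_bigr => x tx; rewrite (big_pred1 (eps x)) => [|e]; first by rewrite mulrC.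
  by rewrite tx andbT eq_sym.
have [d0 _] : exists d0 : dartD, True.
  have : (0 < fcard (@straight_on D) dartD)%N by have [_ -> _] := knotD.
  by case/card_gt0P=> d0 _; exists d0.
have tag_onto (v : 'I_(size D)) : exists d : dartD, tag d = v.
  have [] := @dart_at D v 0; rewrite ?ltn_ord //.
    by have := allP crossD _ (mem_nth (P 0 0) (ltn_ord v)); case: (nth _ D v).
  move=> d; rewrite posE => -[eq_v _]; exists d; exact: val_inj.
have alternating (w : dartD -> F) : (forall x, w (R x) = - w x) ->
    (forall x, w (N x) = - w x) -> w d0 = 0 -> forall x, w x = 0.
  move=> wR wN w0; apply: (dart_connected w0) => x wx; first by rewrite wR wx oppr0.
  by rewrite wN wx oppr0.
have rankA : (size D + 2 <= \rank A + 1)%N.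
  apply: (@rank_kernel_point _ _ _ _ (phi d0)) => g gA g0.
  have hN x : g 0 (phi (N x)) = - g 0 (phi x).
    by apply/eqP; rewrite -addr_eq0 addrC -A_mul gA mxE.
  apply/rowP=> j; have [x <-] := phi_onto j; rewrite [RHS]mxE.
  apply: (alternating (fun x => g 0 (phi x))) => // y; by rewrite phi_other hN.
have rankL : (size D <= \rank L + 1)%N.
  rewrite -mxrank_tr; apply: (@rank_kernel_point _ _ _ _ (tag d0)) => c cL c0.
  have hR x : c 0 (tag (R x)) * sgn (R x) = - (c 0 (tag x) * sgn x).
    apply/eqP; rewrite -addr_eq0 addrC.
    rewrite -(big_edge (fun x => c 0 (tag x) * sgn x)).
    have cLx : (c *m L^T) 0 (eps x) = 0 by rewrite cL mxE.
    apply/eqP; rewrite -[RHS]cLx [RHS]mxE.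
    rewrite (partition_big (fun x => tag x) xpredT) //=; apply: eq_bigr => v _.
    by rewrite !mxE mulr_sumr; apply: eq_bigr => y /andP[_ /eqP ->].
  have hN x : c 0 (tag (N x)) * sgn (N x) = - (c 0 (tag x) * sgn x).
    by rewrite sgn_next mulrN.
  apply/rowP=> v; have [x <-] := tag_onto v; rewrite [RHS]mxE.
  have := alternating _ hR hN; rewrite c0 mul0r => /(_ erefl x)/eqP.
  by rewrite mulf_eq0 signr_eq0 orbF => /eqP.
have AL : A *m L = 0.
  apply/row_matrixP=> j; rewrite row_mul row0; apply/rowP=> v.
  have [d <-] := tag_onto v; rewrite L_mul [RHS]mxE rowE !A_mul next4.
  by ring.
have /choice[rep repK] := eps_onto.
pose u : 'rV[F]_(2 * size D) := \row_e f (rep e).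
have uE x : u 0 (eps x) = f x.
  rewrite mxE; have /eqP := repK (eps x).
  by rewrite eq_sym epsP fconnect_other => /orP[]/eqP->.
have /sub_kermxP uL : u *m L = 0.
  by apply/rowP=> v; have [d <-] := tag_onto v; rewrite L_mul !uE f_node mulr0 mxE.
have /mxrank_leqif_sup[le_rank eq_rank] : (A <= kermx L)%MS by apply/sub_kermxP.
have /submxP[g def_u] : (u <= A)%MS.
  (* With n nodes, [A] has rank at least n + 1, and the kernel of [L] has dimension at most 2n - (n
     - 1). *)
  apply: submx_trans uL _; rewrite -eq_rank eqn_leq le_rank mxrank_ker /=.
  move: (\rank A) (\rank L) rankA rankL => ra rl leA leL.
  rewrite leq_subLR; have := leq_add leL leA.
  by rewrite addnA addnn -mul2n addnACA leq_add2r.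
exists (fun x => g 0 (phi x)); split=> x; first by rewrite phi_face.
by rewrite -uE def_u A_mul.
Qed.
End FaceColoring.

End Faces.

(** * The matrix of crossing relations *)

Section CrossingBound.
Variables (D : diagram).
Hypotheses (knotD : knot_diagram D) (crossD : all is_crossing D).
Let pairD : edges_paired D := knot_paired knotD.
Notation dartD := (dart D).
Notation N := (@next_ccw D).
Notation R := (@other_end D).
Let deg4 := degree4 crossD.
Let N4 := next4 crossD.

(** Over F_2 the constant edge function 1 is a sum of face values, so faces along a common edge get
    different values. *)
Lemma checkerboard : exists b : dartD -> bool,
  (forall x, b (around_face x) = b x) /\ forall x, b (N x) = ~~ b x.
Proof.
have [|x|g [g_face gN]] := @face_coloring D knotD crossD 'F_2 (fun=> 1).
- by [].
- by apply: val_inj.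
exists (fun x => g x == 0); split=> x; first by rewrite g_face.
by have := gN x; case: (g x) => [[|[|k]] ltk] //; case: (g (N x)) => [[|[|l]] ltl].
Qed.

Lemma some_dart : exists d : dartD, True.
Proof.
have : (0 < fcard (@straight_on D) dartD)%N by have [_ -> _] := knotD.
by case/card_gt0P=> d0 _; exists d0.
Qed.

(** Position 1 of a crossing lies on its over-strand. *)
Lemma node_dart (v : 'I_(size D)) : exists d : dartD, pos d = (val v, 1).
Proof.
apply: dart_at; rewrite ?ltn_ord //.
by have := allP crossD _ (mem_nth (P 0 0) (ltn_ord v)); case: (nth _ D v).
Qed.

Lemma pos_iter4 m (d : dartD) : pos (iter m N d) = ((pos d).1, ((pos d).2 + m) %% 4)%N.
Proof. by rewrite pos_iter_next deg4. Qed.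

Lemma iter4 m (d : dartD) : iter (m %% 4) N d = iter m N d.
Proof. by apply: pos_inj; rewrite !pos_iter4 modnDmr. Qed.

Lemma node_orbit (v : 'I_(size D)) (d x : dartD) : pos d = (val v, 1) -> tag x = v ->
  exists2 m, (m < 4)%N & x = iter m N d.
Proof.
move=> pos_d tag_x; have [_ x_lt] := pos_valid x; rewrite -degree_pos deg4 in x_lt.
exists (((pos x).2 + 3) %% 4)%N; first by rewrite ltn_mod.
apply: pos_inj; rewrite iter4 pos_iter4 pos_d /= addnCA -[(1 + 3)%N]/4%N modnDr
  modn_small //.
by rewrite -tag_x !posE.
Qed.

(** Both sums are twice the colour of the over-strand. This form is symmetric in the two strands, as
    [face_coloring] requires. *)
Lemma color_dart p (f : nat -> 'Z_p) : fox_coloring D f ->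
  forall d : dartD, f (edge_of d) + f (edge_of (N (N d))) =
    f (edge_of (N d)) + f (edge_of (N (N (N d)))).
Proof.
move=> col d; have edgeN m : edge_of (iter m N d) =
    nth 0%N (edges_at (node_at D (pos d).1)) (((pos d).2 + m) %% 4).
  by rewrite edge_of_pos pos_iter4.
rewrite (edgeN 1) (edgeN 2) (edgeN 3) -[d in LHS]/(iter 0 N d) (edgeN 0) addn0.
have [lt1] := pos_valid d; have := col _ (mem_nth (P 0 0) lt1).
have := allP crossD _ (mem_nth (P 0 0) lt1).
case: (node_at D _) => [a b c e _ [f_be f_b]|//].
case: (pos d).2 => [|[|[|[|k]]]] //= _; rewrite ?addrA.
- by rewrite -f_b -f_be mulr_natl mulr2n.
- by rewrite [RHS]addrC -f_b -f_be mulr_natl mulr2n.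
- by rewrite [LHS]addrC -f_b -f_be mulr_natl mulr2n addrC.
- by rewrite -f_b -f_be mulr_natl mulr2n.
Qed.

(* [iota] numbers the faces other than the two deleted ones, which lie on the
   two sides of the edge of [xB]. *)
Section Minor.
Variables (phi : dartD -> 'I_(size D + 2)) (b : dartD -> bool) (xB : dartD).
Hypothesis phiP : forall x y, (phi x == phi y) = fconnect (@around_face D) x y.
Hypothesis phi_onto : forall j, exists x, phi x = j.
Hypothesis b_face : forall x, b (around_face x) = b x.
Hypothesis bN : forall x, b (N x) = ~~ b x.
Variable iota : 'I_(size D) -> 'I_(size D + 2).
Hypothesis iota_inj : injective iota.
Hypothesis iotaP : forall j, (j \in codom iota) = (j != phi xB) && (j != phi (N xB)).
Variable base : 'I_(size D) -> dartD.
Hypothesis pos_base : forall v, pos (base v) = (val v, 1)%N.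

Definition ind (x : dartD) (j : 'I_(size D)) : int := (phi x == iota j)%:R.

(** That the over-strand has one colour before and after the crossing reads g x + g (N x) = g (N (N
    x)) + g (N (N (N x))) for [x] in position 1. The corners [x] and [N (N x)] have one checkerboard
    colour, the other two the opposite one; [minorB] keeps the black difference, [minorW] the
    white. *)
Definition minorB : 'M[int]_(size D) := \matrix_(v, j)
  let x := base v in
  if b x then ind x j - ind (N (N x)) j else ind (N x) j - ind (N (N (N x))) j.

Definition minorW : 'M[int]_(size D) := \matrix_(v, j)
  let x := base v in
  if b x then ind (N x) j - ind (N (N (N x))) j else ind x j - ind (N (N x)) j.

Lemma arc_row_ind x y (v : 'rV[int]_(size D)) :
  (forall j, v 0 j = ind x j - ind y j) -> arc_row v.
Proof.
move=> vE; have ex z : exists c, forall j, (phi z == iota j) = (c == Some j).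
  have [/codomP[j phi_z]|z_iota] := boolP (phi z \in codom iota).
    by exists (Some j) => j'; rewrite phi_z (inj_eq iota_inj).
  by exists None => j; apply: contraNF z_iota => /eqP->; exact: codom_f.
have [[c cE] [c' c'E]] := (ex x, ex y); exists c, c' => j.
by rewrite vE /ind cE c'E.
Qed.

Lemma b_connect x y : phi x = phi y -> b x = b y.
Proof. by move/eqP; rewrite phiP => /iter_findex <-; elim: findex => //= m ->. Qed.

Definition black : {set 'I_(size D)} :=
  [set j | [exists x, (phi x == iota j) && b x]].

Lemma black_phi x j : phi x = iota j -> (j \in black) = b x.
Proof.
move=> phi_x; rewrite inE; apply/existsP/idP=> [[y /andP[/eqP phi_y by_]]|bx].
  by rewrite (@b_connect x y) // phi_x.
by exists x; rewrite phi_x eqxx.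
Qed.

Lemma ind_eq0 x j : (j \in black) != b x -> ind x j = 0.
Proof.
move=> neq; rewrite /ind; case: eqP => // phi_x.
by rewrite (black_phi phi_x) eqxx in neq.
Qed.

Lemma minorB_black v j : j \notin black -> minorB v j = 0.
Proof.
move=> /negbTE jB; rewrite mxE /=; case: ifPn => bx; rewrite !ind_eq0 ?subrr //.
all: by rewrite jB ?bN ?bx ?(negbTE bx).
Qed.

Lemma minorW_black v j : j \in black -> minorW v j = 0.
Proof.
move=> jB; rewrite mxE /=; case: ifPn => bx; rewrite !ind_eq0 ?subrr //.
all: by rewrite jB ?bN ?bx ?(negbTE bx).
Qed.

Lemma minor_mul (F : fieldType) (g : dartD -> F) :
  (forall x, g (around_face x) = g x) -> g xB = 0 -> g (N xB) = 0 ->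
  forall h : 'cV[F]_(size D), (forall x j, phi x = iota j -> h j 0 = g x) ->
  forall v, let x := base v in
    (map_mx intr (minorB + minorW) *m h) v 0 =
      g x + g (N x) - g (N (N x)) - g (N (N (N x))).
Proof.
move=> g_face gB gW h hg v x.
have g_connect y z : phi y = phi z -> g y = g z.
  by move/eqP; rewrite phiP => /iter_findex <-; elim: findex => //= m ->.
have sum_ind y : \sum_j (ind y j)%:~R * h j 0 = g y.
  have [/codomP[j phi_y]|] := boolP (phi y \in codom iota).
    rewrite (bigD1 j) //= {1}/ind phi_y eqxx mul1r (hg y) // big1 ?addr0 // =>
      k /negPf neq.
    by rewrite /ind phi_y (inj_eq iota_inj) eq_sym neq mul0r.
  move=> y_iota; rewrite big1 => [|j _]; last first.
    rewrite /ind; case: eqP y_iota => [->|_ _]; last by rewrite mul0r.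
    by rewrite codom_f.
  by move: y_iota; rewrite iotaP negb_and !negbK => /orP[]/eqP/g_connect->.
rewrite -!sum_ind -!sumrN -!big_split mxE; apply: eq_bigr => j _ /=.
rewrite !mxE /= -/x -!mulNr -!mulrDl; congr (_ * _).
by case: (b x); rewrite !(rmorphD, rmorphN) /=; ring.
Qed.

Lemma face_connect (T : Type) (g : dartD -> T) :
  (forall x, g (around_face x) = g x) -> forall y z, phi y = phi z -> g y = g z.
Proof.
move=> g_face y z /eqP; rewrite phiP => /iter_findex <-.
by elim: findex => //= m ->.
Qed.

Lemma deleted_faces (T : Type) (g : dartD -> T) (c : T) :
  (forall x, g (around_face x) = g x) -> g xB = c -> g (N xB) = c ->
  (forall x, phi x \in codom iota -> g x = c) -> forall x, g x = c.
Proof.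
move=> g_face gB gW gI x; have [/gI //|] := boolP (phi x \in codom iota).
rewrite iotaP negb_and !negbK.
by case/orP=> /eqP/(face_connect g_face)->.
Qed.

Lemma face_next (T : Type) (g : dartD -> T) x :
  (forall x, g (around_face x) = g x) -> g (R x) = g (N x).
Proof. by move=> g_face; rewrite -(g_face (R x)) around_face_other. Qed.

(** A kernel vector, extended by 0 to the deleted faces, gives a face function g and edge values f =
    g + g N. Modulo 2 the relation at a crossing makes f agree across both strands, so f is constant
    along the knot; it vanishes at [xB], whose two sides are the deleted faces. Then g agrees across
    every edge and is 0. *)
Lemma minor_odd : \det (map_mx intr (minorB + minorW) : 'M['F_2]_(size D)) != 0.
Proof.
set M := map_mx _ _; rewrite -det_tr; apply/det0P=> -[v v_neq0 vM].
pose h := v^T; have Mh : M *m h = 0 by rewrite -[M]trmxK -trmx_mul vM trmx0.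
pose g x := \sum_j (ind x j)%:~R * h j 0.
have phi_face x : phi (around_face x) = phi x.
  by apply/eqP; rewrite eq_sym phiP fconnect1.
have g_face x : g (around_face x) = g x by rewrite /g /ind phi_face.
have g_out x : phi x \notin codom iota -> g x = 0.
  move=> x_out; rewrite /g big1 // => j _; rewrite /ind; case: eqP => [eq_x|];
    last by rewrite mul0r.
  by rewrite eq_x codom_f in x_out.
have gB : g xB = 0 by rewrite g_out // iotaP eqxx.
have gW : g (N xB) = 0 by rewrite g_out // iotaP eqxx andbF.
have hg x j : phi x = iota j -> h j 0 = g x.
  move=> phi_x; rewrite /g (bigD1 j) //= {1}/ind phi_x eqxx mul1r big1 ?addr0
    // => k /negPf neq.
  by rewrite /ind phi_x (inj_eq iota_inj) eq_sym neq mul0r.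
have node v' : let x := base v' in g x + g (N x) - g (N (N x)) - g (N (N (N x))) = 0.
  by move=> x; rewrite -(minor_mul g_face gB gW hg) -/M Mh mxE.
pose f x := g x + g (N x).
have f_other x : f (R x) = f x.
  by rewrite /f (face_next x g_face) -[N (R x)]/(around_face x) g_face addrC.
have f_straight x : f (straight_on x) = f x.
  rewrite straight_on4 // -[RHS]f_other; move: (R x) => y.
  have [m ltm ->] := node_orbit (pos_base (tag y)) erefl.
  have := node (tag y); rewrite /f /=; move: (base _) => z.
  have F2 (u : 'F_2) : u = 0 \/ u = 1.
    by case: u => [[|[|k]] ltk] //; [left | right]; apply: val_inj.
  case: m ltm => [|[|[|[|m]]]] //= _; rewrite ?N4;
  case: (F2 (g z)) => ->; case: (F2 (g (N z))) => ->;
  case: (F2 (g (N (N z)))) => ->; case: (F2 (g (N (N (N z))))) => -> /eqP //= _;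
  exact: val_inj.
have f0 x : f x = 0.
  have f_xB : f xB = 0 by rewrite /f gB gW addr0.
  have f_iter m y : f (iter m (@straight_on D) y) = f y.
    by elim: m => //= m IHm; rewrite f_straight.
  by have [] := two_orbits knotD xB x => /iter_findex <-; rewrite f_iter ?f_other.
have gN x : g x = 0 -> g (N x) = 0 by move=> gx; have := f0 x; rewrite /f gx add0r.
have g0 x : g x = 0.
  by apply: (@dart_connected D knotD crossD (fun y => g y = 0) xB gB) => y gy;
    rewrite ?(face_next y g_face) gN.
case/eqP: v_neq0; apply/rowP=> j; rewrite [RHS]mxE.
by have [x phi_x] := phi_onto (iota j); have := hg x j phi_x; rewrite mxE g0.
Qed.

(** The normalised face function of the colouring is a nonzero kernel vector: were it zero, all
    edges would have one colour. ['F_p] unfolds to ['Z_(pdiv p)], whence [pdiv p] in the colouring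
    hypotheses. *)
Lemma minor_singular p (f : nat -> 'F_p) : prime p -> odd p ->
  @fox_coloring (pdiv p) D f -> @nontrivial_coloring (pdiv p) D f ->
  \det (map_mx intr (minorB + minorW) : 'M['F_p]_(size D)) = 0.
Proof.
move=> p_prime p_odd col [e1 [e2 [e1D e2D neq]]].
have two_neq0 : 2%:R != 0 :> 'F_p.
  rewrite -(dvdn_pcharf (pchar_Fp p_prime)); apply: contraL p_odd.
  by rewrite dvdn_prime2 // => /eqP->.
pose f' (d : dartD) : 'F_p := f (edge_of d).
have f'_other x : f' (R x) = f' x by rewrite /f' edge_of_other_end.
have f'_node x : f' x - f' (N x) + f' (N (N x)) - f' (N (N (N x))) = 0.
  have eq_x : f' x + f' (N (N x)) = f' (N x) + f' (N (N (N x))) := color_dart col x.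
  by rewrite [f' x - _ + _]addrAC eq_x; ring.
have [g0 [g0_face g0N]] := face_coloring knotD crossD f'_other f'_node.
(* Half sum and half difference of the values on the deleted faces. Subtracting [al] everywhere and
   [be] with checkerboard signs makes both values 0 and changes the edge colours only by the
   constant 2 [al]. *)
pose al := (g0 xB + g0 (N xB)) / 2%:R; pose be := (g0 xB - g0 (N xB)) / 2%:R.
pose g x := g0 x - al - (if b x == b xB then be else - be).
have g_face x : g (around_face x) = g x by rewrite /g g0_face b_face.
have gB : g xB = 0 by rewrite /g eqxx /al /be; field.
have gW : g (N xB) = 0.
  by rewrite /g bN (_ : (~~ b xB == b xB) = false) ?/al ?/be; [field | case: (b xB)].
have /choice[rep repK] := phi_onto.
pose h := \col_j g (rep (iota j)).
have hg x j : phi x = iota j -> h j 0 = g x.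
  by move=> phi_x; rewrite mxE; apply: (face_connect g_face); rewrite repK.
apply: (@det_singular _ _ _ h).
  apply/eqP=> h0; apply: neq.
  have g_0 : forall x, g x = 0.
    apply: deleted_faces => // x /codomP[j phi_x].
    by rewrite -(hg x j phi_x) h0 mxE.
  suff f'_const x : f' x = al + al.
    have [d1 <-] := edge_darts e1D; have [d2 <-] := edge_darts e2D.
    by rewrite -[LHS]/(f' d1) -[RHS]/(f' d2) !f'_const.
  have /eqP := g_0 x; have /eqP := g_0 (N x); rewrite /g g0N bN.
  rewrite !subr_eq !add0r => /eqP-> /eqP->.
  by case: (b x); case: (b xB) => /=; ring.
apply/matrixP=> v k; rewrite (ord1 k) (minor_mul g_face gB gW hg) [RHS]mxE.
set x := base v; have : f' x = f' (N (N x)).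
  rewrite /f' !edge_of_pos (pos_iter4 2 x) pos_base /=.
  have := col _ (mem_nth (P 0 0) (ltn_ord v)).
  have := allP crossD _ (mem_nth (P 0 0) (ltn_ord v)).
  by case: (node_at D v) => [a c d e _ [-> _]|].
rewrite !g0N /g !bN => /eqP; rewrite -subr_eq0 => /eqP eq0; rewrite -[RHS]eq0.
by case: (b x); case: (b xB) => /=; ring.
Qed.

End Minor.
End CrossingBound.

Lemma intr_Fp_eq0 p (d : int) : prime p -> (d%:~R == 0 :> 'F_p) = (p %| `|d|)%N.
Proof.
move=> p_prime; rewrite (dvdn_pcharf (pchar_Fp p_prime)).
by case: d => k; rewrite ?NegzE ?rmorphN ?oppr_eq0 ?abszN.
Qed.

Lemma crossing_bound (D : diagram) p :
  knot_diagram D -> all is_crossing D -> prime p -> odd p -> colored p D ->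
  exists2 k, (p <= 'C(size D, k))%N & (5 <= size D)%N -> (p <= 2 ^ (size D - 2))%N.
Proof.
move=> knotD crossD p_prime p_odd colp.
have pairD := knot_paired knotD.
have [phi [phiP phi_onto]] :=
  orbit_index (around_face_inj pairD) (card_faces knotD crossD).
have [b [b_face bN]] := checkerboard knotD crossD.
have [xB _] := some_dart knotD.
have /choice[base pos_base] := node_dart crossD.
pose A := ~: [set phi xB; phi (next_ccw xB)].
have cardA : #|A| = size D.
  have neq : phi xB != phi (next_ccw xB).
    apply/eqP=> /(b_connect phiP b_face); rewrite bN.
    by case: (b xB).
  by rewrite cardsCs setCK cards2 neq card_ord addnK.
pose iota i := enum_val (cast_ord (esym cardA) i).
have iota_inj : injective iota by move=> i j /enum_val_inj /cast_ord_inj.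
have iotaP j : (j \in codom iota) = (j != phi xB) && (j != phi (next_ccw xB)).
  rewrite -negb_or -in_set2 -in_setC -/A; apply/codomP/idP => [[i ->]|jA].
    exact: enum_valP.
  exists (cast_ord cardA (enum_rank_in jA j)).
  by rewrite /iota cast_ordK enum_rankK_in.
pose B := minorB phi b iota base; pose W := minorW phi b iota base.
pose J := black phi b iota.
have arc_B i : arc_row (row i B).
  by case bi: (b (base i)); apply: (arc_row_ind iota_inj) => j; rewrite !mxE /= bi.
have arc_W i : arc_row (row i W).
  by case bi: (b (base i)); apply: (arc_row_ind iota_inj) => j; rewrite !mxE /= bi.
have B_J i j : j \notin J -> B i j = 0 by apply: minorB_black.
have W_J i j : j \in J -> W i j = 0 by apply: minorW_black.
pose d := \det (B + W).
have d_neq0 : d != 0.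
  have : \det (map_mx intr (B + W) : 'M['F_2]_(size D)) != 0.
    exact: (minor_odd knotD crossD b phiP phi_onto iota_inj iotaP pos_base).
  by apply: contraNneq => d0; rewrite det_map_mx -/d d0.
have p_dvd : (p %| `|d|)%N.
  rewrite -intr_Fp_eq0 // -det_map_mx; rewrite -(pdiv_id p_prime) in colp.
  have [f [colf nontriv]] := colp; apply/eqP.
  exact: (minor_singular knotD crossD phiP phi_onto b_face bN iota_inj iotaP
    pos_base p_prime p_odd colf).
have p_le : (p <= `|d|)%N by rewrite dvdn_leq // absz_gt0.
have d_le : (`|d| <= #|[set t | \det (mixed B W t) != 0]|)%N.
  by have := det_le_card arc_B arc_W; rewrite -/d natz -abszE lez_nat.
exists #|J|; first by apply: leq_trans p_le (leq_trans d_le (card_good_bin B_J W_J)).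
move=> n_ge5; apply: leq_trans p_le (leq_trans d_le _).
exact: (card_good_pow2 arc_B arc_W B_J W_J).
Qed.

(** * Diagrams as labelled walks *)

Local Open Scope nat_scope.

Definition next_label (m i : nat) : nat := if i.+1 == m then 0 else i.+1.

(* The walk [(i, j, sg)] stands for a crossing that a walk along the knot, with
   edges numbered 0, ..., m - 1, passes under after the edge [i] and over after
   the edge [j]; [sg] tells from which side it is crossed. *)
Definition walk_node (m : nat) (c : nat * nat * bool) : node :=
  let: (i, j, sg) := c in
  let i' := next_label m i in let j' := next_label m j in
  if sg then X i j i' j' else X i j' i' j.

Definition labels (s : seq (nat * nat * bool)) : seq nat :=
  flatten [seq [:: c.1.1; c.1.2] | c <- s].

Section WalkLabelling.
Variables (D : diagram).
Hypotheses (knotD : knot_diagram D) (crossD : all is_crossing D).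
Let pairD : edges_paired D := knot_paired knotD.
Notation dartD := (dart D).
Notation N := (@next_ccw D).
Notation R := (@other_end D).
Notation s := (@straight_on D).
Let s_inj : injective s := straight_on_inj pairD.
Variable d0 : dartD.
Let m := 2 * size D.

(** The darts along which the walk started at [d0] leaves a node; by the others it arrives. *)
Let out x := fconnect s d0 x.

Lemma out_other x : out (R x) = ~~ out x.
Proof.
have outR y : out y -> ~~ out (R y).
  move=> oy; apply/negP=> oRy; have /negP[] := straight_on_reverse knotD y.
  by apply: connect_trans oRy; rewrite (fconnect_sym s_inj).
have [/outR /negPf-> //|nx] := boolP (out x).
have [|] := two_orbits knotD d0 x; first by rewrite -/(out x) (negPf nx).
case/iter_findex; move: (findex _ _ _) => k <- {nx}.
elim: k => [|k IHk] /=; first by rewrite other_endK // /out connect0.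
rewrite /out (same_connect_r (fconnect_sym s_inj) (fconnect1 s _)) straight_on_back //.
Qed.

(** Exchanging the two ends of every edge maps leaving darts onto arriving ones, so the cycle holds
    half of the 4 [size D] darts. *)
Lemma order_walk : order s d0 = m.
Proof.
have eq_card : #|[predC out]| = order s d0.
  rewrite /order -(card_image (can_inj (other_endK pairD)) [pred x | out x]).
  apply: eq_card => x; rewrite !inE; apply/idP/imageP=> [ox|[y oy ->]].
    by exists (R x); rewrite ?other_endK // inE out_other.
  by rewrite out_other negbK.
have := cardC out; rewrite eq_card card_dart (size_edges4 crossD)
  -[#|out|]/(order s d0).
by rewrite addnn -mul2n -[4]/(2 * 2) -mulnA => /eqP; rewrite eqn_pmul2l // => /eqP.
Qed.

Let es := [seq edge_of x | x <- orbit s d0].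

Lemma nth_es i : i < m -> nth 0 es i = edge_of (iter i s d0).
Proof.
move=> lt_i; rewrite (nth_map d0) ?size_orbit ?order_walk //.
by rewrite /orbit nth_traject ?order_walk.
Qed.

Lemma size_es : size es = m.
Proof. by rewrite size_map size_orbit order_walk. Qed.

Lemma uniq_es : uniq es.
Proof.
rewrite map_inj_in_uniq ?orbit_uniq // => x y; rewrite -!fconnect_orbit => ox oy eq_e.
have [//|def_x] := same_edge pairD eq_e; have := out_other y.
by rewrite -def_x /out ox oy.
Qed.

Let lab (x : dartD) := index (edge_of x) es.

Lemma lab_iter i : i < m -> lab (iter i s d0) = i.
Proof. by move=> lt_i; rewrite /lab -nth_es // index_uniq ?uniq_es ?size_es. Qed.

Lemma edge_in_es (x : dartD) : edge_of x \in es.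
Proof.
have [ox|ox] := boolP (out x).
  by apply: map_f; rewrite -fconnect_orbit.
rewrite -(edge_of_other_end pairD); apply: map_f; rewrite -fconnect_orbit.
by rewrite -/(out _) out_other.
Qed.

Lemma lab_lt x : lab x < m.
Proof. by rewrite -size_es index_mem edge_in_es. Qed.

Lemma lab_next x : ~~ out x -> lab (N (N x)) = next_label m (lab x).
Proof.
rewrite -out_other => oRx; have := lab_lt x; have -> : lab x = lab (R x).
  by rewrite /lab edge_of_other_end.
have -> : N (N x) = s (R x) by rewrite straight_on4 // other_endK.
have := findex_max oRx; rewrite order_walk; have := iter_findex oRx.
move: (findex _ _ _) => k <- lt_k; rewrite lab_iter // -iterS /next_label.
case: eqP => [eq_m|/eqP neq]; last by rewrite lab_iter // ltn_neqAle neq.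
rewrite eq_m -order_walk iter_order // => _; apply: (@lab_iter 0).
by apply: leq_ltn_trans lt_k.
Qed.

(** The move [relabel] takes an injection of all numbers, so names outside the diagram are shifted
    past the labels. *)
Definition relabel_walk (x : nat) := if x \in es then index x es else x + m.

Lemma relabel_walk_inj : injective relabel_walk.
Proof.
rewrite /relabel_walk => x y; case: ifP => x_es; case: ifP => y_es.
- by move/(congr1 (nth 0 es)); rewrite !nth_index.
- by move=> eq_xy; have := x_es; rewrite -index_mem eq_xy size_es ltnNge leq_addl.
- by move=> eq_xy; have := y_es; rewrite -index_mem -eq_xy size_es ltnNge leq_addl.
by move/addIn.
Qed.

Lemma relabel_walk_edge (x : dartD) : relabel_walk (edge_of x) = lab x.
Proof. by rewrite /relabel_walk edge_in_es. Qed.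

Lemma out_opposite x : out (N (N x)) = ~~ out x.
Proof.
rewrite -out_other -[x in LHS](other_endK pairD) -straight_on4 //.
by rewrite /out (same_connect_r (fconnect_sym s_inj) (fconnect1 s (R x))).
Qed.

Lemma walk_of_node i : i < size D -> exists c : nat * nat * bool,
  (map_node relabel_walk (node_at D i) = walk_node m c \/
   half_turn (map_node relabel_walk (node_at D i)) = walk_node m c) /\
  forall x : dartD, (pos x).1 = i -> ~~ out x -> lab x \in [:: c.1.1; c.1.2].
Proof.
move=> lt_i; have [x0 pos_x0] : exists x0 : dartD, pos x0 = (i, 0).
  by apply: dart_at => //; have := allP crossD _ (mem_nth (P 0 0) lt_i);
    case: (node_at D i).
have pos_x k : pos (iter k N x0) = (i, k %% 4) by rewrite (pos_iter4 crossD) pos_x0.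
have lab_x k : k < 4 -> relabel_walk (nth 0 (edges_at (node_at D i)) k) = lab
  (iter k N x0).
  by move=> lt_k; rewrite -relabel_walk_edge edge_of_pos pos_x modn_small.
have [[l0 l1] [l2 l3]] := ((lab_x 0 isT, lab_x 1 isT), (lab_x 2 isT, lab_x 3 isT)).
have in_node x : (pos x).1 = i -> exists2 k, k < 4 & x = iter k N x0.
  move=> x1; have [_ lt2] := pos_valid x; rewrite -degree_pos degree4 // in lt2.
  exists (pos x).2 => //; apply: pos_inj; rewrite pos_x modn_small // -x1.
  exact: surjective_pairing.
have [o2 o3] := (out_opposite x0, out_opposite (N x0)).
have := allP crossD _ (mem_nth (P 0 0) lt_i).
case: (node_at D i) l0 l1 l2 l3 => [a b c d|//] /= l0 l1 l2 l3 _.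
rewrite l0 l1 l2 l3 /half_turn /=.
have nx0 : ~~ out x0 -> lab (N (N x0)) = next_label m (lab x0) := @lab_next x0.
have nx1 : ~~ out (N x0) -> lab (N (N (N x0))) = next_label m (lab (N x0)).
  exact: lab_next.
have nx2 : ~~ out (N (N x0)) -> lab x0 = next_label m (lab (N (N x0))).
  by move/lab_next; rewrite next4.
have nx3 : ~~ out (N (N (N x0))) -> lab (N x0) = next_label m (lab (N (N (N x0)))).
  by move/lab_next; rewrite next4.
rewrite o2 in nx2; rewrite o3 in nx3.
case o0: (out x0) o2 nx0 nx2 => /= o2 nx0 nx2;
  case o1: (out (N x0)) o3 nx1 nx3 => /= o3 nx1 nx3.
(* The cases are the directions of the two strands; the half turn is used when the under-strand
   arrives at position 2 instead of 0. *)
- exists (lab (N (N x0)), lab (N (N (N x0))), true).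
  split; first by right; rewrite /= -nx2 // -nx3.
  by move=> x /in_node[[|[|[|[|k]]]] //= _ ->];
    rewrite ?o0 ?o1 ?o2 ?o3 //= !inE eqxx ?orbT.
- exists (lab (N (N x0)), lab (N x0), false).
  split; first by right; rewrite /= -nx2 // -nx1.
  by move=> x /in_node[[|[|[|[|k]]]] //= _ ->];
    rewrite ?o0 ?o1 ?o2 ?o3 //= !inE eqxx ?orbT.
- exists (lab x0, lab (N (N (N x0))), false).
  split; first by left; rewrite /= -nx0 // -nx3.
  by move=> x /in_node[[|[|[|[|k]]]] //= _ ->];
    rewrite ?o0 ?o1 ?o2 ?o3 //= !inE eqxx ?orbT.
- exists (lab x0, lab (N x0), true).
  split; first by left; rewrite /= -nx0 // -nx1.
  by move=> x /in_node[[|[|[|[|k]]]] //= _ ->];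
    rewrite ?o0 ?o1 ?o2 ?o3 //= !inE eqxx ?orbT.
Qed.

End WalkLabelling.

Lemma all2_map (T U V : Type) (r : U -> V -> bool) (f : T -> U) (g : T -> V) s :
  all2 r (map f s) (map g s) = all (fun x => r (f x) (g x)) s.
Proof. by elim: s => //= x s ->. Qed.

Lemma size_labels w : size (labels w) = (2 * size w)%N.
Proof. by elim: w => //= c w IHw; rewrite mulnS -IHw. Qed.

Lemma walk_labelling (D : diagram) :
  knot_diagram D -> all is_crossing D ->
  exists w, [/\ size w = size D, perm_eq (labels w) (iota 0 (2 * size D)) &
                same_knot D (map (walk_node (2 * size D)) w)].
Proof.
move=> knotD crossD; have [d0 _] := some_dart knotD.
have pairD := knot_paired knotD.
have /choice[c cP] i : exists c, i < size D ->
    (map_node (relabel_walk d0) (node_at D i) = walk_node (2 * size D) c \/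
     half_turn (map_node (relabel_walk d0) (node_at D i)) = walk_node (2 * size D) c) /\
    forall x : dart D, (pos x).1 = i -> ~~ fconnect (@straight_on D) d0 x ->
      relabel_walk d0 (edge_of x) \in [:: c.1.1; c.1.2].
  have [lt_i|_] := boolP (i < size D); last by exists (0, 0, true).
  have [c [c_node c_lab]] := walk_of_node knotD crossD d0 lt_i; exists c => _;
    split=> //.
  by move=> x x1 ox; rewrite relabel_walk_edge //; apply: c_lab.
exists (mkseq c (size D)); split; first by rewrite size_mkseq.
  (* The edge [i] of the walk arrives at some node, where it is recorded; 2n labels among 2n entries
     then occur once each. *)
  have sub : {subset iota 0 (2 * size D) <= labels (mkseq c (size D))}.
    move=> i; rewrite mem_iota => /= lt_i.
    pose x := other_end (iter i (@straight_on D) d0).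
    have [lt1 _] := pos_valid x; have [_ c_lab] := cP _ lt1.
    have : i \in [:: (c (pos x).1).1.1; (c (pos x).1).1.2].
      rewrite -[X in X \in _](lab_iter knotD crossD d0 lt_i) -relabel_walk_edge //.
      rewrite -(edge_of_other_end pairD); apply: c_lab => //.
      by rewrite out_other // negbK fconnect_iter.
    move=> i_c; apply/flattenP; exists [:: (c (pos x).1).1.1; (c (pos x).1).1.2] => //.
    by apply: map_f; apply: map_f; rewrite mem_iota.
  have le_size : size (labels (mkseq c (size D))) <= size (iota 0 (2 * size D)).
    by rewrite size_labels size_mkseq size_iota.
  have [_ eq_mem] := uniq_min_size (iota_uniq _ _) sub le_size.
  apply: uniq_perm => [||x]; rewrite ?iota_uniq ?eq_mem //.
  exact: leq_size_uniq (iota_uniq _ _) sub le_size.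
have knotD1 := knot_relabel (@relabel_walk_inj D knotD crossD d0) knotD.
apply: same_knot_trans (same_knot_relabel (@relabel_walk_inj D knotD crossD d0)
  knotD) _.
apply: same_knot_half_turns => //.
have -> : map (map_node (relabel_walk d0)) D =
    mkseq (fun i => map_node (relabel_walk d0) (node_at D i)) (size D).
  by move: (relabel_walk d0) => f; rewrite -{1}(mkseq_nth (P 0 0) D) -map_comp.
rewrite /mkseq -map_comp all2_map.
apply/allP=> i; rewrite mem_iota => /= /cP[c_node _].
by rewrite !inE; case: c_node => ->; rewrite eqxx ?orbT.
Qed.

(** * Enumeration of small diagrams *)

Local Notation walk := (seq (nat * nat * bool)).

(** Forgets which strand is on top by listing the smaller label first; flipping the sign preserves
    the shadow. *)
Definition uncross (c : nat * nat * bool) : nat * nat * bool :=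
  let: (i, j, sg) := c in if i < j then c else (j, i, ~~ sg).

(** Signed perfect matchings of the labels. Pairing the first free label with a later one lists each
    unordered matching once. *)
Fixpoint shapes (n : nat) (av : seq nat) : seq walk :=
  if n is n'.+1 then
    if av is i :: r then
      [seq c :: w | c <- [seq (i, j, sg) | j <- r, sg <- [:: true; false]],
                    w <- shapes n' (rem c.1.2 r)]
    else [::]
  else [:: [::]].

Definition overcrossings (w : walk) : seq walk :=
  foldr (fun c ts => [seq c' :: t | c' <- [:: c; (c.1.2, c.1.1, ~~ c.2)], t <- ts])
        [:: [::]] w.

(* The half-edge [k] of the crossing [i] is numbered [4 * i + k]. *)
Definition face_succ (e : seq nat) (x : nat) : nat :=
  let a := nth 0 e x in let i := index a e in
  let y := if i == x then i.+1 + index a (drop i.+1 e) else i in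
  if y %% 4 == 3 then y - 3 else y.+1.

(** Tests whether [x] is the least half-edge of its face. Exhausted fuel [k] answers [true], which
    can only raise [face_count], and only a lower bound on it is used. *)
Fixpoint first_in_face (tab : seq nat) (k x y : nat) : bool :=
  if k is k'.+1 then
    let z := nth 0 tab y in
    if z < x then false else if z == x then true else first_in_face tab k' x z
  else true.

Definition face_count (e : seq nat) : nat :=
  let tab := [seq face_succ e x | x <- iota 0 (size e)] in
  count (fun x => first_in_face tab (size e) x x) (iota 0 (size e)).

Definition planar_walk (n : nat) (w : walk) : bool :=
  n + 2 <= face_count (edges (map (walk_node (2 * n)) w)).

(** [Some j] when the walk passes under after the edge [x], with [j] the arriving edge of the strand
    above; [None] when it passes over there. *)
Definition over_label (w : walk) (x : nat) : option nat :=
  if [seq c <- w | c.1.1 == x] is c :: _ then Some c.1.2 else None.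

Definition color_rule (p m : nat) (w : walk) (l : seq nat) (x : nat) : bool :=
  let y := nth 0 l x in let z := nth 0 l (next_label m x) in
  if over_label w x is Some j then (2 * nth 0 l j) %% p == (y + z) %% p
  else y == z.

(** [l] lists the colours of the edges walked so far. After an overcrossing the colour is copied;
    after an undercrossing it is forced if the upper edge is already coloured, and otherwise
    guessed. Starting from colour 0, nontrivial means that some colour is nonzero. *)
Fixpoint color_search (p m : nat) (w : walk) (k : nat) (l : seq nat) : bool :=
  if k is k'.+1 then
    let x := (size l).-1 in let y := nth 0 l x in
    if over_label w x is Some j then
      if j < size l then
        color_search p m w k' (rcons l ((2 * nth 0 l j + (p - y)) %% p))
      else has (fun z => color_search p m w k' (rcons l z)) (iota 0 p)
    else color_search p m w k' (rcons l y)
  else all (color_rule p m w l) (iota 0 m) && has (fun y => y != 0) l.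

(** Changes of starting edge and of direction. The shift by 1 matches the numbering of [trefoil] and
    [figure_eight]; from m on it keeps the map injective. *)
Definition dihedral (m : nat) : seq (nat -> nat) :=
  [seq (fun x => if x < m then (x + r) %% m + 1 else x + 1) | r <- iota 0 m] ++
  [seq (fun x => if x < m then (m + r - x) %% m + 1 else x + 1) | r <- iota 0 m].

Definition turn_towards (E : diagram) (v : node) : node :=
  if v \in E then v else half_turn v.

Definition equiv_walk (m : nat) (E : diagram) (w : walk) : bool :=
  has (fun f => perm_eq
    (map (turn_towards E) (map (map_node f) (map (walk_node m) w))) E) (dihedral m).

(* Conditionals instead of boolean connectives: the virtual machine evaluates
   both sides of a connective. *)
Definition check_walks (n p : nat) (E : diagram) : bool :=
  all (fun w => if planar_walk n w then
      all (fun t => if color_search p (2 * n) t (2 * n).-1 [:: 0] then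
             has (equiv_walk (2 * n)^~ t) [:: E; mirror E] else true)
        (overcrossings w)
    else true) (shapes n (iota 0 (2 * n))).

Definition pos_code (D : diagram) (d : dart D) : nat := 4 * (pos d).1 + (pos d).2.

(** * Correctness of the planarity test *)

Section FaceCount.
Variables (D : diagram).
Hypotheses (knotD : knot_diagram D) (crossD : all is_crossing D).
Let pairD : edges_paired D := knot_paired knotD.

Lemma nth_edges4 E i k : all is_crossing E -> i < size E -> k < 4 ->
  nth 0 (edges E) (4 * i + k) = nth 0 (edges_at (node_at E i)) k.
Proof.
elim: E i => //= v E IHE [|i] /andP[crv crE] lt_i lt_k.
  rewrite muln0 /edges /= nth_cat; case: v crv => // a b c d _.
  by rewrite lt_k.
rewrite /edges /= nth_cat; case: v crv => // a b c d _.
by rewrite mulnS -addnA ltnNge leq_addr /= addnC -addnBA // subnn addn0 IHE.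
Qed.

Lemma pos_codeK (d : dart D) :
  pos_code d %/ 4 = (pos d).1 /\ pos_code d %% 4 = (pos d).2.
Proof.
have [_] := pos_valid d; rewrite -degree_pos degree4 // => lt2.
by rewrite /pos_code mulnC modnMDl divnMDl // modn_small // divn_small // addn0.
Qed.

Lemma pos_code_inj : injective (@pos_code D).
Proof.
move=> x y eq_xy; apply: pos_inj;
  rewrite [LHS]surjective_pairing [RHS]surjective_pairing.
by have [<- <-] := pos_codeK x; have [<- <-] := pos_codeK y; rewrite eq_xy.
Qed.

Lemma pos_code_lt (d : dart D) : pos_code d < size (edges D).
Proof.
have [lt1] := pos_valid d; rewrite -degree_pos degree4 // => lt2.
rewrite size_edges4 // /pos_code -addnS (leq_trans (n := 4 * (pos d).1 + 4))
  ?leq_add2l //.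
by rewrite -mulnSr leq_mul2l.
Qed.

Lemma pos_code_onto x : x < size (edges D) -> exists d : dart D, pos_code d = x.
Proof.
rewrite size_edges4 // => lt_x;
  have lt_i : x %/ 4 < size D by rewrite ltn_divLR // mulnC.
have [|d pos_d] := @dart_at D (x %/ 4) (x %% 4) lt_i.
  have := allP crossD _ (mem_nth (P 0 0) lt_i); case: (node_at D _) => // *.
  by rewrite ltn_mod.
by exists d; rewrite /pos_code pos_d /= mulnC -divn_eq.
Qed.

Lemma edge_of_code (d : dart D) : nth 0 (edges D) (pos_code d) = edge_of d.
Proof.
have [lt1] := pos_valid d; rewrite -degree_pos degree4 // => lt2.
by rewrite /pos_code nth_edges4 // -edge_of_pos.
Qed.

Lemma face_succP (d : dart D) :
  pos_code (around_face d) = face_succ (edges D) (pos_code d).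
Proof.
pose e := edges D; rewrite /face_succ -/e; cbv zeta; rewrite edge_of_code;
  set a := edge_of d.
set i := index a e; set y := if i == _ then _ else _.
have a_e : a \in e by apply: edge_of_mem.
have lt_i : i < size e by rewrite index_mem.
suff -> : y = pos_code (other_end d).
  rewrite (pos_codeK (other_end d)).2 /around_face /pos_code pos_next degree4 //=.
  have [_] := pos_valid (other_end d); rewrite -degree_pos degree4 //.
  case: (pos _).2 => [|[|[|[|k]]]] // _.
  - by rewrite -[1 %% 4]/1 addn0 addn1.
  - by rewrite -[2 %% 4]/2 addnS.
  - by rewrite -[3 %% 4]/3 addnS.
  by rewrite modnn addn0 addnK.
have a_drop : a \in drop i.+1 e.
  have := pairD a_e; rewrite -/e -{1}(cat_take_drop i e) (drop_nth 0) // count_cat.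
  rewrite /= nth_index // eqxx (count_memPn _) => [|]; last first.
    by apply/negP=> /index_ltn; rewrite ltnn.
  by rewrite -has_pred1 has_count; case: count.
have nth_y : nth 0 e y = a.
  by rewrite /y; case: eqP => _; [rewrite -nth_drop nth_index | exact: nth_index].
have lt_y : y < size e.
  rewrite /y; case: eqP => // _; rewrite -index_mem size_drop in a_drop.
  by rewrite -ltn_subRL.
have y_neq : y != pos_code d.
  rewrite /y; case: ifP => [/eqP<-|/negbT //].
  by rewrite gtn_eqF // ltn_addr.
have [z def_z] := pos_code_onto lt_y; rewrite -def_z; congr pos_code.
apply: other_end_unique => //; first by apply: contraNneq y_neq => eq_z;
  rewrite -def_z eq_z.
by rewrite -edge_of_code def_z nth_y.
Qed.

(** The dart of least code in a face is counted, since following the face from it never meets a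
    smaller code. *)
Lemma face_count_ge : size D + 2 <= face_count (edges D).
Proof.
rewrite -(card_faces knotD crossD).
pose minimal (d : dart D) := [forall d', fconnect (@around_face D) d d' ==>
  (pos_code d <= pos_code d')].
have sym := fconnect_sym (around_face_inj pairD).
apply: (@leq_trans #|[pred d | minimal d]|).
  apply: (@leq_trans #|[set froot (@around_face D) d | d in [pred d | minimal
    d]]|); last first.
    exact: leq_imset_card.
  apply: subset_leq_card; apply/subsetP=> x; rewrite inE andbT => /eqP root_x.
  have [d /= xd min_d] := @arg_minnP _ x (fconnect (@around_face D) x)
    (@pos_code D) (connect0 _ _).
  apply/imsetP; exists d; last first.
    by rewrite -[LHS]root_x; apply/eqP; rewrite (root_connect sym).
  rewrite inE; apply/forallP=> d'; apply/implyP=> dd'; apply: min_d.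
  exact: connect_trans xd dd'.
rewrite cardE -(size_map (@pos_code D)) /face_count;
  set tab := [seq face_succ _ x | x <- _].
rewrite -size_filter.
have tabE (d : dart D) : nth 0 tab (pos_code d) = pos_code (around_face d).
  rewrite /tab (nth_map 0) ?size_iota ?pos_code_lt // nth_iota ?pos_code_lt //.
  by rewrite face_succP.
apply: uniq_leq_size; first by rewrite (map_inj_uniq pos_code_inj) enum_uniq.
move=> x /mapP[d]; rewrite mem_enum inE => /forallP min_d -> {x}.
rewrite mem_filter mem_iota pos_code_lt andbT.
have : fconnect (@around_face D) d d by [].
elim: (size _) {2 4}d => //= k IHk d' dd'; rewrite tabE.
have dd1 : fconnect (@around_face D) d (around_face d').
  exact: (connect_trans dd' (fconnect1 (@around_face D) d')).
rewrite ltnNge (implyP (min_d _) dd1) /=; case: ifP => // _.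
exact: IHk.
Qed.

End FaceCount.

(** * Completeness of the list of shapes *)

Lemma uncross_turn m c :
  walk_node m (uncross c) \in
    [:: walk_node m c; quarter_turn (walk_node m c);
      iter 3 quarter_turn (walk_node m c)].
Proof.
case: c => [[i j] sg] /=; case: ifP => _; first by rewrite inE eqxx.
by case: sg; rewrite /= !inE eqxx ?orbT.
Qed.

Lemma uncross_planar n w : knot_diagram (map (walk_node (2 * n)) w) -> size w = n ->
  planar_walk n (map uncross w).
Proof.
move=> knotw size_w; have knotu : knot_diagram (map (walk_node (2 * n)) (map
  uncross w)).
  apply: knot_turns knotw; rewrite -map_comp all2_map; apply/allP=> c _.
  exact: uncross_turn.
rewrite /planar_walk -{1}size_w -(size_map uncross w) -(size_map (walk_node (2 * n))).
apply: face_count_ge knotu _; apply/allP=> _ /mapP[[[i j] sg] _ ->].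
by rewrite /walk_node; case: sg.
Qed.

Lemma overcrossings_mem t : t \in overcrossings (map uncross t).
Proof.
elim: t => [|c t IHt]; first by rewrite inE.
apply/allpairsP; exists (c, t); split=> //; rewrite !inE.
by case: c => [[i j] sg] /=; case: ifP; rewrite /= ?negbK ?eqxx ?orbT.
Qed.

Lemma perm_map_lift (T U : eqType) (f : T -> U) s s' : perm_eq (map f s) s' ->
  exists2 t, perm_eq s t & map f t = s'.
Proof.
case: s => [|x0 s]; first by rewrite perm_sym => /perm_nilP ->; exists [::].
rewrite perm_sym => /(perm_iotaP (f x0))[Is eqIs ->]; rewrite size_map in eqIs.
exists [seq nth x0 (x0 :: s) i | i <- Is].
  by rewrite perm_sym; apply/perm_iotaP; exists Is.
rewrite -map_comp; apply/eq_in_map=> i; rewrite (perm_mem eqIs) mem_iota add0n => lt_i.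
by rewrite [RHS](nth_map x0).
Qed.

Lemma perm_labels w w' : perm_eq w w' -> perm_eq (labels w) (labels w').
Proof. by move=> ww'; apply: perm_flatten; apply: perm_map. Qed.

Lemma labels_uncross w : perm_eq (labels (map uncross w)) (labels w).
Proof.
elim: w => //= [[[i j] sg] w IHw]; rewrite /labels /=.
case: ifP => _ /=; first by rewrite !perm_cons.
by rewrite -[X in perm_eq X _]/([:: j] ++ [:: i] ++ _) perm_catCA /= !perm_cons.
Qed.

(** The least label must come first in its pair, because pairs are increasing; removing this pair
    gives the induction. *)
Lemma shapesP n av w : size w = n -> sorted ltn av -> perm_eq (labels w) av ->
  all (fun c => c.1.1 < c.1.2) w -> exists2 w', perm_eq w w' & w' \in shapes n av.
Proof.
elim: n av w => [|n IHn] av w size_w sort_av perm_av incr_w.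
  by rewrite (size0nil size_w); exists [::].
case: av sort_av perm_av => [|i r] sort_av perm_av.
  by have := perm_size perm_av; rewrite size_labels size_w.
have i_min x : x \in i :: r -> i <= x.
  rewrite inE => /orP[/eqP->//|xr]; apply: ltnW.
  by move: sort_av; rewrite /= path_sortedE;
    [case/andP=> /allP/(_ x xr) | exact: ltn_trans].
have : i \in labels w by rewrite (perm_mem perm_av) mem_head.
case/flattenP=> _ /mapP[c cw ->] i_c.
have sub_lab x : x \in [:: c.1.1; c.1.2] -> x \in i :: r.
  rewrite -(perm_mem perm_av) => xc; apply/flattenP; exists [:: c.1.1; c.1.2] => //.
  exact: map_f.
have lt_c := allP incr_w c cw; have {i_c} c1 : c.1.1 = i.
  move: i_c; rewrite !inE => /orP[/eqP-> //|/eqP eq_i].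
  by have := i_min _ (sub_lab c.1.1 (mem_head _ _)); rewrite eq_i leqNgt lt_c.
have perm_w := perm_to_rem cw.
have perm_r : perm_eq (c.1.2 :: labels (rem c w)) r.
  rewrite -(perm_cons i) -[in X in perm_eq X _]c1.
  by apply: perm_trans perm_av; rewrite perm_sym; exact: perm_labels perm_w.
have c2_r : c.1.2 \in r by rewrite -(perm_mem perm_r) mem_head.
have perm_r' : perm_eq (labels (rem c w)) (rem c.1.2 r).
  by rewrite -(perm_cons c.1.2) (perm_trans perm_r) // perm_to_rem.
have [|||w' ww' w'S] := IHn (rem c.1.2 r) (rem c w) _ _ perm_r' _.
- by rewrite size_rem // size_w.
- by apply: (subseq_sorted ltn_trans (rem_subseq _ _)); apply: path_sorted sort_av.
- by apply/allP=> x /mem_rem; exact: (allP incr_w).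
exists (c :: w'); first by rewrite (perm_trans perm_w) // perm_cons.
apply/allpairsPdep; exists c, w'; split=> //.
by apply/allpairsP; exists (c.1.2, c.2); split=> //=; [case: (c.2) | rewrite -c1;
  case: (c) => [[]]].
Qed.

(** * Completeness of the colour search *)

Section ColorSearch.
Variables (m : nat) (w : walk).
Hypothesis perm_w : perm_eq (labels w) (iota 0 m).

Lemma label_cases x : x < m ->
  (exists2 c, c \in w & over_label w x = Some c.1.2 /\ c.1.1 = x) \/
  (exists2 c, c \in w & over_label w x = None /\ c.1.2 = x).
Proof.
move=> lt_x; have : x \in labels w by rewrite (perm_mem perm_w) mem_iota.
case/flattenP=> _ /mapP[c cw ->] x_c; rewrite /over_label.
case def_f: [seq c <- w | c.1.1 == x] => [|c' f].
  right; exists c => //; split=> //; move: x_c; rewrite !inE => /orP[]/eqP eq_x //.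
  have : c \in [seq c <- w | c.1.1 == x] by rewrite mem_filter eq_x eqxx.
  by rewrite def_f.
have : c' \in [seq c <- w | c.1.1 == x] by rewrite def_f mem_head.
by rewrite mem_filter => /andP[/eqP eq_x c'w]; left; exists c'.
Qed.

Lemma color_search_complete p (g : nat -> nat) :
  (forall x, g x < p) -> g 0 = 0 ->
  (forall x, x < m -> if over_label w x is Some j
     then 2 * g j = g x + g (next_label m x) %[mod p] else g x = g (next_label m x)) ->
  (exists2 x, x < m & g x != 0) ->
  color_search p m w m.-1 [:: 0].
Proof.
move=> g_lt g0 g_rule [x0 lt_x0 g_x0].
have m_gt0 : 0 < m by case: m lt_x0.
have lt_label x : x < m -> if over_label w x is Some j then j < m else true.
  move=> /label_cases[[c cw [-> _]]|[c cw [-> _]] //].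
  have : c.1.2 \in labels w.
    by apply/flattenP; exists [:: c.1.1; c.1.2]; rewrite ?map_f // !inE eqxx orbT.
  by rewrite (perm_mem perm_w) mem_iota.
have next_lt x : x < m -> next_label m x < m.
  by rewrite /next_label; case: eqP => // /eqP neq lt_x; rewrite ltn_neqAle neq.
(* With k steps left, the branch that follows [g] holds its values on the first m - k edges. *)
suff search k : k < m -> color_search p m w k [seq g x | x <- iota 0 (m - k)].
  have := search m.-1; rewrite prednK // leqnn => /(_ isT).
  have -> : m - m.-1 = 1 by rewrite -{1}(prednK m_gt0) subSnn.
  by rewrite /= g0.
elim: k => [|k IHk] lt_k /=.
  rewrite subn0; apply/andP; split.
    apply/allP=> x; rewrite mem_iota /= => lt_x; have := g_rule x lt_x.
    rewrite /color_rule !(nth_map 0) ?size_iota ?next_lt // !nth_iota ?next_lt //.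
    have := lt_label x lt_x; case: over_label => [j lt_j /eqP|_ ->];
      last by rewrite eqxx.
    by rewrite (nth_map 0) ?size_iota // nth_iota.
  by apply/hasP; exists (g x0) => //; apply: map_f; rewrite mem_iota.
have step z : z = g (m - k.+1) ->
    color_search p m w k (rcons [seq g x | x <- iota 0 (m - k.+1)] z).
  move=> ->; have := IHk (ltnW lt_k); rewrite -[m - k]prednK ?subn_gt0 1?ltnW //.
  by rewrite -subnS -addn1 iotaD map_cat cats1.
rewrite size_map size_iota; set i := (m - k.+1).-1.
have i_succ : i.+1 = m - k.+1 by rewrite prednK ?subn_gt0.
have lt_im : i.+1 < m by rewrite i_succ ltn_subrL.
have next_i : next_label m i = m - k.+1.
  by rewrite /next_label ltn_eqF.
have lt_i : i < m := ltnW lt_im.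
rewrite (nth_map 0) ?size_iota -?i_succ // nth_iota // add0n.
rewrite i_succ; have := g_rule i lt_i; rewrite next_i.
case: over_label => [j eq_j|->]; last exact: step.
case: ifP => [lt_j|_]; last first.
  by apply/hasP; exists (g (m - k.+1)); [rewrite mem_iota g_lt | apply: step].
apply: step; rewrite (nth_map 0) ?size_iota // nth_iota // add0n.
rewrite -modnDml eq_j modnDml addnAC subnKC ?(ltnW (g_lt _)) //.
by rewrite modnDl modn_small.
Qed.

(** Subtracting [f 0] preserves the relations and gives edge 0 the colour 0. The form [q.+2] makes
    the modulus of ['Z_] compute to the intended one. *)
Lemma color_search_colored q : colored q.+2 (map (walk_node m) w) ->
  color_search q.+2 m w m.-1 [:: 0].
Proof.
case=> f [col [a [b [aw bw neq_ab]]]].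
pose h x := (f x - f 0)%R; pose g x : nat := h x.
have rule c : c \in w -> let i := c.1.1 in let j := c.1.2 in
    h j = h (next_label m j) /\ (h j + h j = h i + h (next_label m i))%R.
  move=> cw; have := col _ (map_f (walk_node m) cw).
  rewrite /h; case: (c) => [[i j] sg] /=; case: sg => -[f_j f_i];
    rewrite mulr_natl mulr2n in f_i.
    split; first by rewrite f_j.
    by rewrite addrACA f_i addrACA.
  split; first by rewrite f_j.
  by rewrite -f_j addrACA f_i addrACA.
have edge_lt x : x \in edges (map (walk_node m) w) -> x < m.
  have lab_lt c : c \in w -> c.1.1 < m /\ c.1.2 < m.
    move=> cw; have mem_lab y : y \in [:: c.1.1; c.1.2] -> y < m.
      move=> yc; have : y \in labels w by apply/flattenP; exists [:: c.1.1;
        c.1.2]; rewrite ?map_f.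
      by rewrite (perm_mem perm_w) mem_iota.
    by split; apply: mem_lab; rewrite !inE eqxx ?orbT.
  have next_lt y : y < m -> next_label m y < m.
    rewrite /next_label; case: eqP => [_|/eqP neq] lt_y;
      first exact: leq_ltn_trans lt_y.
    by rewrite ltn_neqAle neq.
  case/flattenP=> _ /mapP[_ /mapP[c cw ->] ->]; have [] := lab_lt c cw.
  case: c {cw} => [[i j] sg] /= lt_i lt_j.
  by case: sg; rewrite /= !inE => /or4P[]/eqP->; rewrite ?next_lt.
apply: (@color_search_complete _ g) => [x||x lt_x|].
- exact: ltn_ord.
- by rewrite /g /h subrr.
- have [[c cw [-> c_x]]|[c cw [-> c_x]]] := label_cases lt_x;
  have [over under] := rule c cw.
    have := congr1 (@nat_of_ord _) under; rewrite -c_x /= => eq_mod.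
    by rewrite mul2n -addnn; exact: eq_mod.
  by rewrite -c_x /g -over.
have [ha|ha] := eqVneq (h a) 0%R; last by exists a; rewrite ?edge_lt.
have [hb|hb] := eqVneq (h b) 0%R; last by exists b; rewrite ?edge_lt.
by case: neq_ab; apply: (@addIr _ (- f 0)%R); rewrite -/(h a) -/(h b) ha hb.
Qed.

End ColorSearch.

(** * Classification *)

Lemma extend_inj m (h : nat -> nat) :
  {in gtn m &, injective h} -> (forall x, x < m -> h x < m) ->
  injective (fun x => if x < m then h x + 1 else x + 1).
Proof.
move=> h_inj h_lt x y; case: ifP => lt_x; case: ifP => lt_y.
- by move/addIn/h_inj; apply.
- by move/addIn=> eq_y; rewrite -eq_y h_lt in lt_y.
- by move/addIn=> eq_x; rewrite eq_x h_lt in lt_x.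
by move/addIn.
Qed.

Lemma equiv_walk_same m E w : equiv_walk m E w ->
  knot_diagram (map (walk_node m) w) -> same_knot (map (walk_node m) w) E.
Proof.
move=> eqvE knotw.
have [f f_inj perm_E] : exists2 f, injective f & perm_eq
    (map (turn_towards E) (map (map_node f) (map (walk_node m) w))) E.
  move: eqvE; rewrite /equiv_walk has_cat !has_map.
  case/orP=> /hasP[r]; rewrite mem_iota => /= lt_r perm_E; eexists; try exact: perm_E.
    apply: (extend_inj (h := fun x => (x + r) %% m)) => [x y|x lt_x]; rewrite ?inE.
      by move=> lt_x lt_y /eqP; rewrite eqn_modDr !modn_small // => /eqP.
    by rewrite ltn_mod (leq_ltn_trans _ lt_r).
  apply: (extend_inj (h := fun x => (m + r - x) %% m)) => [x y|x lt_x]; rewrite ?inE.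
    move=> lt_x lt_y /eqP; rewrite -(eqn_modDr (x + y)) addnA subnK; last first.
      by rewrite (leq_trans (ltnW lt_x)) ?leq_addr.
    rewrite [x + y]addnC addnA subnK; last by rewrite (leq_trans (ltnW lt_y)) ?leq_addr.
    by rewrite eqn_modDl !modn_small // => /eqP.
  by rewrite ltn_mod (leq_ltn_trans _ lt_r).
have knotf := knot_relabel f_inj knotw.
have skt : same_knot (map (map_node f) (map (walk_node m) w))
    (map (turn_towards E) (map (map_node f) (map (walk_node m) w))).
  apply: same_knot_half_turns => //; rewrite -{1}[X in all2 _ X]map_id all2_map.
  by apply/allP=> v _; rewrite /turn_towards; case: ifP; rewrite !inE eqxx ?orbT.
apply: same_knot_trans (same_knot_relabel f_inj knotw) (same_knot_trans skt _).
by apply: same_knot_reorder perm_E _; apply/(same_knot_diagram skt).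
Qed.

Lemma classify_by_check n q E (D : diagram) :
  check_walks n q.+2 E -> knot_diagram D -> all is_crossing D -> size D = n ->
  colored q.+2 D -> same_knot_or_mirror D E.
Proof.
move=> check_n knotD crossD size_D colD.
have [w [size_w perm_w skw]] := walk_labelling knotD crossD.
rewrite size_D in size_w perm_w skw.
have uniq_w : uniq (labels w) by rewrite (perm_uniq perm_w) iota_uniq.
have incr_u : all (fun c => c.1.1 < c.1.2) (map uncross w).
  apply/allP=> _ /mapP[[[i j] sg] cw ->]; rewrite /uncross.
  have neq_ij : i != j.
    have := perm_uniq (perm_labels (perm_to_rem cw)); rewrite uniq_w => /esym /=.
    by rewrite inE negb_or => /andP[/andP[]].
  by case: (ltngtP i j) neq_ij.
have perm_u : perm_eq (labels (map uncross w)) (iota 0 (2 * n)).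
  exact: perm_trans (labels_uncross w) perm_w.
have size_u : size (map uncross w) = n by rewrite size_map.
have [w' uw' w'S] := shapesP size_u (iota_ltn_sorted 0 (2 * n)) perm_u incr_u.
(* [shapes] contains the uncrossed walk only up to order; the reordering is lifted to the walk
   itself, so that [t] appears among the [overcrossings] of [w']. *)
have [t wt def_w'] := perm_map_lift uw'.
have knotw : knot_diagram (map (walk_node (2 * n)) w) by apply/(same_knot_diagram skw).
have perm_t := perm_map (walk_node (2 * n)) wt.
have knott := knot_reorder perm_t knotw.
have skt : same_knot D (map (walk_node (2 * n)) t).
  exact: same_knot_trans skw (same_knot_reorder perm_t knotw).
have planar_w' : planar_walk n w'.
  by rewrite -def_w' uncross_planar // -(perm_size wt).
have perm_lt : perm_eq (labels t) (iota 0 (2 * n)).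
  by apply: perm_trans perm_w; rewrite perm_sym perm_labels.
have search_t := color_search_colored perm_lt ((colored_same_knot _ skt).1 colD).
have := allP check_n _ w'S; rewrite planar_w' => /allP/(_ t).
rewrite -def_w' overcrossings_mem search_t => /(_ isT) /=.
rewrite orbF => /orP[] /equiv_walk_same /(_ knott) skE; [left | right].
  exact: same_knot_trans skt skE.
exact: same_knot_trans skt skE.
Qed.

Lemma check_trefoil : check_walks 3 3 trefoil.
Proof. by vm_compute. Qed.

Lemma check_figure_eight : check_walks 4 5 figure_eight.
Proof. by vm_compute. Qed.

Lemma knot_crossings (D : diagram) : knot_diagram D -> all is_crossing D -> 0 < size D.
Proof.
move=> knotD crossD; have [d _] := some_dart knotD.
by have [lt1 _] := pos_valid d; apply: leq_ltn_trans lt1.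
Qed.

Lemma not_colored_point p a : ~ colored p [:: P a a].
Proof.
case=> f [_ [x [y []]]]; rewrite !inE !orbb => /eqP-> /eqP->.
by [].
Qed.

(** A diagram with the least number of crossings may carry marked points; absorbing them preserves
    that number, and the bare circle has no nontrivial colouring. *)
Lemma minimal_crossing_diagram p (K : diagram) :
  knot_diagram K -> colorable p K ->
  exists D, [/\ same_knot K D, knot_diagram D, all is_crossing D, colored p D &
                size D = crossing_number K].
Proof.
move=> knotK [D0 [skD0 colD0]].
rewrite /crossing_number; case: ex_minnP => n /asboolP[D skD crD] _.
have knotD : knot_diagram D by apply/(same_knot_diagram skD).
have [E [skE crE] caseE] := absorb_points knotD.
have skKE := same_knot_trans skD skE.
have knotE : knot_diagram E by apply/(same_knot_diagram skKE).
have colE : colored p E.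
  by apply: (colored_same_knot p (same_knot_trans (same_knot_sym skD0) skKE)).1.
case: caseE => [crossE|[a defE]]; last by rewrite defE in colE;
  case: (@not_colored_point p a).
exists E; split=> //; rewrite -crD -crE; symmetry.
by apply/eqP; rewrite -all_count.
Qed.

Lemma crossing_number_le (K E : diagram) :
  same_knot_or_mirror K E -> crossing_number K <= crossings E.
Proof.
rewrite /crossing_number; case: ex_minnP => n _ n_min [skE|skE]; apply: n_min.
  by apply/asboolP; exists E.
apply/asboolP; exists (mirror E) => //.
by rewrite /crossings count_map; apply: eq_count; case.
Qed.

(** [n.-1.+1] is n, except that it is 1 for n = 0, where ['C(0, 0)] is 1. *)
Lemma bin_le_small n k : n <= 3 -> 'C(n, k) <= n.-1.+1.
Proof. by case: n => [|[|[|[|n]]]] //; case: k => [|[|[|[|k]]]]. Qed.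

Theorem theorem16 (p : nat) (K : diagram) (p_prime : prime p) (p_odd : odd p)
    (K_knot : knot_diagram K) (K_col : colorable p K) :
  crossing_number K = trunc_log 2 p + 2 <->
  (p = 3 /\ same_knot_or_mirror K trefoil) \/
  (p = 5 /\ same_knot_or_mirror K figure_eight).
Proof.
have [D [skD knotD crossD colD size_D]] := minimal_crossing_diagram K_knot K_col.
have [k p_le_bin p_le_pow] := crossing_bound knotD crossD p_prime p_odd colD.
have D_gt0 := knot_crossings knotD crossD.
have classify n q E : p = q.+2 -> check_walks n q.+2 E -> size D = n ->
  same_knot_or_mirror K E.
  move=> def_p check_n size_n; rewrite def_p in colD.
  by case: (classify_by_check check_n knotD crossD size_n colD) => skE; [left | right];
    apply: same_knot_trans skD skE.
have p_gt2 : 2 < p by apply: odd_prime_gt2.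
split=> [eq_cr|].
  have le_p : 2 ^ (size D - 2) <= p.
    by rewrite size_D eq_cr addnK trunc_logP // prime_gt0.
  have lt_p : p < 2 ^ (size D - 1).
    by rewrite size_D eq_cr addn2 subn1 /= trunc_log_ltn.
  have D_lt5 : size D < 5.
    rewrite ltnNge; apply/negP=> D_ge5; have := p_le_pow D_ge5.
    rewrite leq_eqVlt ltnNge le_p orbF => /eqP eq_p.
    move: p_odd; rewrite eq_p oddX orbF subn_eq0 leqNgt.
    by rewrite (leq_trans _ D_ge5).
  move: D_gt0 le_p lt_p D_lt5 p_le_bin.
  case eq_n: (size D) => [|[|[|[|[|n]]]]] //= _ le_p lt_p _ p_le_bin.
  - by have := leq_trans p_gt2 (ltnW lt_p).
  - by have := leq_trans p_gt2 (ltnW lt_p).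
  - left; have def_p : p = 3.
      by move: lt_p p_gt2; rewrite -[2 ^ _]/4 ltnS => le3 ge3; apply/eqP;
        rewrite eqn_leq le3.
    by split=> //; apply: (classify _ _ _ def_p check_trefoil).
  right; have def_p : p = 5.
    have p_le6 : p <= 6.
      (* Row 4 of Pascal's triangle has maximum 6, and 5 is the only odd number from 4 to 6. *)
      by apply: leq_trans p_le_bin _; case: k => [|[|[|[|[|k]]]]] //.
    have five q : 4 <= q -> q <= 6 -> odd q -> q = 5 by do 7!case: q => [|q] //.
    exact: five.
  by split=> //; apply: (classify _ _ _ def_p check_figure_eight).
(* The given diagrams bound the crossing number from above. From below, n <= 3 would give p <= n,
   which forces n = 3 for p = 3 and is absurd for p = 5. *)
case=> -[def_p skK]; have := crossing_number_le skK; rewrite -size_D => D_le.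
  rewrite def_p in p_le_bin *; apply/eqP; rewrite eqn_leq D_le.
  by rewrite (leq_trans p_le_bin) // (leq_trans (bin_le_small k D_le)) // prednK.
rewrite def_p in p_le_bin *; apply/eqP; rewrite eqn_leq D_le ltnNge.
apply/negP=> D_le3; have := leq_trans p_le_bin (bin_le_small k D_le3).
by rewrite prednK // ltnNge (leq_trans D_le3).
Qed.
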